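(* Let $\mathcal A$ be an approximately unital operator algebra and let $Y$ be a doubly $\sigma\Delta$-$\mathcal A$-rigged module. Then there exist operator algebras $\mathcal A_0\subseteq\mathbb B(H)$ and $\mathcal B\subseteq\mathbb B(K)$ with contractive approximate identities, and a completely isometric map $\phi:Y\to\mathbb B(H,K)$, for some Hilbert spaces $H,K$, such that $\mathcal A_0\sim_{\sigma TRO}\mathcal B$ and $\mathcal B\sim_{\sigma TRO}\phi(Y)$. In case $\mathcal A$ is a $C^\star$-algebra and $Y$ is a $\sigma\Delta$-$\mathcal A$-Hilbert module, then moreover $\mathcal A_0\simeq I_{\mathcal A}(Y)$ and $\mathcal B\simeq\mathbb K_{\mathcal A}(Y)$.
   Context: Approximately unital means having a contractive approximate identity. $\mathbb B(H,K)$ is the space of bounded operators $H\to K$; $\overline{[Z\,X]}$, $\overline{[Z\,W\,X]}$ denote norm closures of linear spans of products. A linear subspace $M\subseteq\mathbb B(H,K)$ is a TRO if $MM^\star M\subseteq M$. A norm closed TRO $M$ is a $\sigma$-TRO if there are sequences $(m_i),(n_j)$ in $M$ with $\lim_n\sum_{i=1}^n m_im_i^\star m=m$ and $\lim_t\sum_{j=1}^t m\,n_j^\star n_j=m$ for all $m\in M$, and $\|\sum_{i=1}^n m_im_i^\star\|\le1$, $\|\sum_{j=1}^t n_j^\star n_j\|\le1$ for all $n,t$. Operator spaces $X\subseteq\mathbb B(H,K)$, $W\subseteq\mathbb B(L,R)$ are $\sigma$-TRO equivalent, $X\sim_{\sigma TRO}W$, if there are $\sigma$-TROs $M_1\subseteq\mathbb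 B(H,L)$, $M_2\subseteq\mathbb B(K,R)$ with $X=\overline{[M_2^\star WM_1]}$ and $W=\overline{[M_2XM_1^\star]}$. A right $\mathcal A$-module $Y$ (an operator space) is a $\sigma\Delta$-$\mathcal A$-rigged module if there are a completely isometric homomorphism $a:\mathcal A\to a(\mathcal A)\subseteq\mathbb B(H)$, a $\sigma$-TRO $M\subseteq\mathbb B(H,K)$ with $M^\star M\,a(\mathcal A)\subseteq a(\mathcal A)$, and a surjective complete isometry $\rho:Y\to\overline{[M\,a(\mathcal A)]}$ that is a right $\mathcal A$-module map. It is a doubly $\sigma\Delta$-$\mathcal A$-rigged module if these can be chosen with also $\overline{[M^\star M\,a(\mathcal A)]}=\overline{[a(\mathcal A)\,M^\star M]}$. If $\mathcal A$ is a $C^\star$-algebra, a $\sigma\Delta$-$\mathcal A$-rigged module is called a $\sigma\Delta$-$\mathcal A$-Hilbert module; it is a right Hilbert $\mathcal A$-module with inner product $\langle y,z\rangle=a^{-1}(\rho(y)^\star\rho(z))$. For a right Hilbert $\mathcal A$-module $Y$, $I_{\mathcal A}(Y)$ is the closed linear span of $\{\langle y,z\rangle:y,z\in Y\}$ (an ideal of $\mathcal A$), and $\mathbb K_{\mathcal A}(Y)$ is the $C^\star$-algebra of ''compact'' adjointable operators on $Y$. Here $\simeq$ is $*$-isomorphism. *)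

(* Defs.v *)
From HB Require Import structures.
From mathcomp Require Import all_boot all_order all_algebra.
From mathcomp Require Import sesquilinear.
From mathcomp Require Import complex.
From mathcomp Require Import all_classical all_reals all_analysis.

Set Implicit Arguments.
Unset Strict Implicit.
Unset Printing Implicit Defensive.

Import Order.TTheory GRing.Theory Num.Theory.
Import numFieldNormedType.Exports.

Local Open Scope classical_set_scope.
Local Open Scope ring_scope.
Local Open Scope complex_scope.

(* The norm of a normed module over R[i] takes its values in R[i]; rnorm is
   the same (real) number as an element of R. *)
Definition rnorm (R : realType) (V : normedModType R[i]) (x : V) : R :=
  complex.Re `|x|.

Section RealNorm.
Variables (R : realType) (V : normedModType R[i]).
Implicit Types x y : V.

Lemma rnormE x : (rnorm x)%:C = `|x|.
Proof. exact: RRe_real. Qed.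

Lemma le_rnorm x (r : R) : (rnorm x <= r) = (`|x| <= r%:C).
Proof. by rewrite -rnormE lecR. Qed.

Lemma rnorm_ge0 x : 0 <= rnorm x.
Proof. by rewrite -ler0c rnormE. Qed.

Lemma rnorm0 : rnorm (0 : V) = 0.
Proof. by apply: (@complexI R); rewrite rnormE normr0. Qed.

Lemma rnorm_eq0 x : rnorm x = 0 -> x = 0.
Proof. by move=> x0; apply/normr0_eq0; rewrite -rnormE x0. Qed.

Lemma rnormD x y : rnorm (x + y) <= rnorm x + rnorm y.
Proof. by rewrite le_rnorm rmorphD/= !rnormE ler_normD. Qed.

Lemma rnormZ (c : R[i]) x : rnorm (c *: x) = complex.Re `|c| * rnorm x.
Proof.
have c_real : `|c| = (complex.Re `|c|)%:C by rewrite RRe_real.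
apply: (@complexI R); rewrite rnormE normrZ c_real.
by move: (complex.Re `|c|) => r; rewrite rmorphM/= rnormE.
Qed.

End RealNorm.

Section BoundedOperators.
Variables (R : realType) (V W : normedModType R[i]).

Definition bounded_op : {pred V -> W} :=
  [pred f : V -> W | `[< linear f /\
     exists M : R, forall x, rnorm (f x) <= M * rnorm x >]].

Lemma bounded_opP (f : V -> W) :
  reflect (linear f /\ exists M : R, forall x, rnorm (f x) <= M * rnorm x)
    (f \in bounded_op).
Proof. exact: asboolP. Qed.

Lemma bounded_op_submod_closed : submod_closed bounded_op.
Proof.
split.
  apply/bounded_opP; split=> [c x y|].
    by rewrite /= scaler0 addr0.
  by exists 0 => x; rewrite mul0r rnorm0.
move=> c f g /bounded_opP[fl [M fM]] /bounded_opP[gl [N gN]].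
apply/bounded_opP; split=> [d x y|].
  rewrite !fctE fl gl !scalerDr !scalerA (mulrC c) -!addrA; congr (_ + _).
  by rewrite [RHS]addrCA.
exists (complex.Re `|c| * M + N) => x.
rewrite !fctE (le_trans (rnormD _ _))// rnormZ mulrDl lerD//.
by rewrite -mulrA ler_wpM2l// -ler0c RRe_real.
Qed.

HB.instance Definition _ :=
  GRing.isSubmodClosed.Build R[i] (V -> W) bounded_op
    bounded_op_submod_closed.

Record bop := Bop { bop_fun :> V -> W ; bopP : bop_fun \in bounded_op }.

HB.instance Definition _ := [isSub for bop_fun].
HB.instance Definition _ := [Choice of bop by <:].
HB.instance Definition _ := [SubChoice_isSubLmodule of bop by <:].

Lemma bop_linear (f : bop) : linear f.
Proof. by case: f => f /= /bounded_opP[]. Qed.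

HB.instance Definition _ (f : bop) :=
  GRing.isLinear.Build R[i] V W _ (bop_fun f) (bop_linear f).

Lemma bop_bounded (f : bop) : exists M : R, forall x, rnorm (f x) <= M * rnorm x.
Proof. by case: f => f /= /bounded_opP[]. Qed.

Definition unit_values (f : bop) : set R :=
  [set rnorm (f x) | x in [set x | `|x| <= 1]].

Definition opnorm (f : bop) : R[i] := (sup (unit_values f))%:C.

Lemma unit_values_has_sup f : has_sup (unit_values f).
Proof.
split; first by exists (rnorm (f 0)), 0; rewrite //= normr0.
have [M fM] := bop_bounded f; exists (Num.max 0 M) => _ [x /= x1 <-].
rewrite (le_trans (fM x))// (@le_trans _ _ (Num.max 0 M * rnorm x))//.
  by rewrite ler_wpM2r ?rnorm_ge0// le_max lexx orbT.
by rewrite ler_piMr ?le_max ?lexx// le_rnorm.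
Qed.

Lemma opnorm_ub (f : bop) x : `|f x| <= opnorm f * `|x|.
Proof.
have [->|x0] := eqVneq x 0; first by rewrite linear0 !normr0 mulr0.
have nx0 : rnorm x != 0 by apply: contra_neq x0; exact: rnorm_eq0.
have nx : 0 < rnorm x by rewrite lt_neqAle eq_sym nx0 rnorm_ge0.
rewrite -!rnormE /opnorm -rmorphM lecR.
have := sup_upper_bound (unit_values_has_sup f).
move=> /(_ (rnorm (f ((rnorm x)^-1%:C *: x)))) fx.
have : rnorm (f ((rnorm x)^-1%:C *: x)) <= sup (unit_values f).
  apply: fx; exists ((rnorm x)^-1%:C *: x) => //=.
  rewrite normrZ -rnormE ger0_norm ?ler0c ?invr_ge0 ?rnorm_ge0//.
  by rewrite -rmorphM/= mulVf.
rewrite linearZ/= rnormZ ger0_norm ?ler0c ?invr_ge0 ?rnorm_ge0//=.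
by rewrite ler_pdivrMl// mulrC.
Qed.

Lemma opnorm_le (f : bop) (M : R) : 0 <= M ->
  (forall x, rnorm (f x) <= M * rnorm x) -> opnorm f <= M%:C.
Proof.
move=> M0 fM; rewrite /opnorm lecR; apply: ge_sup.
  by have [] := unit_values_has_sup f.
move=> _ [x /= x1 <-]; rewrite (le_trans (fM x))// ler_piMr//.
by rewrite le_rnorm.
Qed.

Lemma opnorm_ge0 f : 0 <= opnorm f.
Proof.
rewrite /opnorm ler0c; apply: (@le_trans _ _ (rnorm (f 0))).
  exact: rnorm_ge0.
apply: (sup_upper_bound (unit_values_has_sup f)).
by exists 0; rewrite //= normr0.
Qed.

Lemma opnormRe f : (complex.Re (opnorm f))%:C = opnorm f.
Proof. by []. Qed.

Lemma opnorm_ubR (f : bop) x : rnorm (f x) <= complex.Re (opnorm f) * rnorm x.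
Proof. by rewrite le_rnorm rmorphM/= rnormE opnorm_ub. Qed.

Lemma ler_opnormD f g : opnorm (f + g) <= opnorm f + opnorm g.
Proof.
rewrite -[opnorm f]opnormRe -[opnorm g]opnormRe -rmorphD.
apply: opnorm_le => [|x].
  by rewrite -ler0c rmorphD addr_ge0// opnorm_ge0.
by rewrite (le_trans (rnormD _ _))// mulrDl lerD// opnorm_ubR.
Qed.

Lemma opnorm_le_scale (c : R[i]) f : opnorm (c *: f) <= `|c| * opnorm f.
Proof.
have c_real : `|c| = (complex.Re `|c|)%:C by rewrite RRe_real.
have c_ge0 : 0 <= complex.Re `|c| by rewrite -ler0c -c_real.
rewrite c_real -[opnorm f]opnormRe.
have f_ge0 : 0 <= complex.Re (opnorm f) by rewrite -ler0c opnormRe opnorm_ge0.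
have rnormcf x : rnorm ((c *: f) x) = complex.Re `|c| * rnorm (f x).
  exact: rnormZ.
move: (complex.Re `|c|) c_ge0 rnormcf => r r_ge0 rnormcf.
rewrite -rmorphM; apply: opnorm_le => [|x]; first exact: mulr_ge0.
by rewrite rnormcf -mulrA ler_wpM2l// opnorm_ubR.
Qed.

Lemma opnormZ (c : R[i]) f : opnorm (c *: f) = `|c| * opnorm f.
Proof.
apply/eqP; rewrite eq_le opnorm_le_scale/=.
have [->|c0] := eqVneq c 0; first by rewrite normr0 mul0r opnorm_ge0.
rewrite -ler_pdivlMl ?normr_gt0// -normfV.
by rewrite -{1}[f](scalerK c0) opnorm_le_scale.
Qed.

Lemma opnorm_eq0 f : opnorm f = 0 -> f = 0.
Proof.
move=> f0; apply/val_inj/funext => x /=; apply/normr0_eq0/eqP.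
by rewrite eq_le normr_ge0 andbT (le_trans (opnorm_ub f x))// f0 mul0r.
Qed.

HB.instance Definition _ :=
  Lmodule_isNormed.Build R[i] bop ler_opnormD opnormZ opnorm_eq0.

End BoundedOperators.

Section Composition.
Variables (R : realType) (U V W : normedModType R[i]).

Lemma bcomp_subproof (S : bop V W) (T : bop U V) : S \o T \in @bounded_op R U W.
Proof.
apply/bounded_opP; split=> [c x y|]; first by rewrite /= !linearP.
have [M SM] := bop_bounded S; have [N TN] := bop_bounded T.
exists (Num.max 0 M * N) => x /=.
rewrite (le_trans (SM _))// (@le_trans _ _ (Num.max 0 M * rnorm (T x)))//.
  by rewrite ler_wpM2r ?rnorm_ge0// le_max lexx orbT.
by rewrite -mulrA ler_wpM2l// le_max lexx.
Qed.

Definition bcomp (S : bop V W) (T : bop U V) : bop U W :=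
  Bop (bcomp_subproof S T).

End Composition.
Notation "S \bo T" := (bcomp S T) (at level 40, left associativity).

Section Spans.
Variables (R : realType) (V : normedModType R[i]).

Definition linear_subspace (S : set V) : Prop :=
  S 0 /\ forall (c : R[i]) x y, S x -> S y -> S (c *: x + y).

Definition lspan (S : set V) : set V :=
  [set v | exists n (c : 'I_n -> R[i]) (s : 'I_n -> V),
     (forall i, S (s i)) /\ v = \sum_i c i *: s i].

Definition cspan (S : set V) : set V := closure (lspan S).

End Spans.

Definition bprod (R : realType) (U V W : normedModType R[i])
    (X : set (bop V W)) (Z : set (bop U V)) : set (bop U W) :=
  [set S \bo T | S in X & T in Z].

(* The adjoint of T with respect to two (possibly algebra-valued) inner
   products; it is 0 if T has no bounded adjoint. *)
Definition adjoint_wrt (R : realType) (D : Type) (V W : normedModType R[i])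
    (fV : V -> V -> D) (fW : W -> W -> D) (T : bop V W) : bop W V :=
  xget 0 [set S : bop W V | forall x y, fW (T x) y = fV x (S y)].

(* The inner product is linear in its first argument and conjugate-linear in
   its second one. *)
HB.mixin Record isHilbert (R : realType) H of CompleteNormedModule R[i] H := {
  hdot : {dot H for Num.conj};
  hdotE : forall x : H, hdot x x = `|x| ^+ 2
}.

#[short(type="hilbertType")]
HB.structure Definition Hilbert (R : realType) :=
  {H of CompleteNormedModule R[i] H & isHilbert R H}.

(* Between Hilbert spaces the adjoint always exists, by Riesz representation. *)
Definition adj (R : realType) (H K : hilbertType R) : bop H K -> bop K H :=
  adjoint_wrt (@hdot R H) (@hdot R K).

Section MatrixNorm.
Variables (R : realType) (H K : hilbertType R).

(* The norm of T as an operator from the Hilbert sum H^n to K^n. *)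
Definition opmxnorm (n : nat) (T : 'M[bop H K]_n) : R :=
  sup [set Num.sqrt (\sum_i rnorm (\sum_j T i j (x j)) ^+ 2)
      | x in [set x : 'I_n -> H | \sum_j rnorm (x j) ^+ 2 <= 1]].

End MatrixNorm.

(* An operator space is a normed space with matrix norms that is completely
   isometric to a linear subspace of some B(H, K). *)
HB.mixin Record isOperatorSpace (R : realType) V of NormedModule R[i] V := {
  mxnorm : forall n : nat, 'M[V]_n -> R;
  mxnorm_rep : exists (H K : hilbertType R) (j : {linear V -> bop H K}),
    (forall v, `|j v| = `|v|) /\
    (forall n (x : 'M[V]_n), mxnorm n x = opmxnorm (map_mx j x))
}.

#[short(type="opspaceType")]
HB.structure Definition OperatorSpace (R : realType) :=
  {V of NormedModule R[i] V & isOperatorSpace R V}.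

Section BopOperatorSpace.
Variables (R : realType) (H K : hilbertType R).

Lemma bop_mxnorm_rep :
  exists (H' K' : hilbertType R) (j : {linear bop H K -> bop H' K'}),
    (forall v, `|j v| = `|v|) /\
    (forall n (x : 'M[bop H K]_n), opmxnorm x = opmxnorm (map_mx j x)).
Proof. by exists H, K, idfun; split=> // n x; rewrite map_mx_id. Qed.

HB.instance Definition _ :=
  isOperatorSpace.Build R (bop H K) bop_mxnorm_rep.

End BopOperatorSpace.

Definition completely_isometric (R : realType) (V W : opspaceType R)
    (f : V -> W) : Prop :=
  forall n (x : 'M[V]_n), mxnorm n (map_mx f x) = mxnorm n x.

(* Completeness makes the image of A in B(H) norm closed. The algebra need not
   have a unit. *)
HB.mixin Record isOperatorAlgebra (R : realType) A
    of OperatorSpace R A & Complete A := {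
  opmul : A -> A -> A;
  opmul_rep : exists (H : hilbertType R) (j : {linear A -> bop H H}),
    completely_isometric j /\ (forall x y, j (opmul x y) = j x \bo j y)
}.

#[short(type="opalgType")]
HB.structure Definition OperatorAlgebra (R : realType) :=
  {A of OperatorSpace R A & Complete A & isOperatorAlgebra R A}.

HB.mixin Record isRightOperatorModule (R : realType) (A : opalgType R) Y
    of OperatorSpace R Y := {
  ract : Y -> A -> Y;
  ract_linearl : forall (a : A) (c : R[i]) (y z : Y),
    ract (c *: y + z) a = c *: ract y a + ract z a;
  ract_linearr : forall (y : Y) (c : R[i]) (a b : A),
    ract y (c *: a + b) = c *: ract y a + ract y b;
  ractA : forall (y : Y) (a b : A), ract (ract y a) b = ract y (opmul a b)
}.

#[short(type="rightOpModType")]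
HB.structure Definition RightOperatorModule (R : realType) (A : opalgType R) :=
  {Y of OperatorSpace R Y & isRightOperatorModule R A Y}.

(* Nets are encoded as functions on a type equipped with a proper filter. *)
Definition has_cai (R : realType) (V : normedModType R[i])
    (mul : V -> V -> V) (S : set V) : Prop :=
  exists (T : Type) (F : set_system T) (e : T -> V),
    [/\ ProperFilter F,
        forall t, S (e t) /\ `|e t| <= 1,
        forall x, S x -> mul (e t) x @[t --> F] --> x
      & forall x, S x -> mul x (e t) @[t --> F] --> x].

Definition approximately_unital (R : realType) (A : opalgType R) : Prop :=
  has_cai (@opmul R A) setT.

Definition concrete_operator_algebra (R : realType) (H : hilbertType R)
    (S : set (bop H H)) : Prop :=
  [/\ linear_subspace S, closed S & forall x y, S x -> S y -> S (x \bo y)].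

Section SigmaTRO.
Variables (R : realType) (H K : hilbertType R).
Implicit Type M : set (bop H K).

Definition is_TRO M : Prop :=
  linear_subspace M /\
  forall x y z, M x -> M y -> M z -> M (x \bo adj y \bo z).

Definition is_sigmaTRO M : Prop :=
  [/\ is_TRO M, closed M &
   exists p q : nat -> bop H K,
   [/\ forall i, M (p i) /\ M (q i),
       forall m, M m -> \sum_(i < n) (p i \bo adj (p i) \bo m) @[n --> \oo] --> m,
       forall m, M m -> \sum_(j < t) (m \bo adj (q j) \bo q j) @[t --> \oo] --> m,
       forall n : nat, `|\sum_(i < n) (p i \bo adj (p i))| <= 1
     & forall t : nat, `|\sum_(j < t) (adj (q j) \bo q j)| <= 1]].

End SigmaTRO.

Definition sigmaTRO_equiv (R : realType) (H K L Q : hilbertType R)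
    (X : set (bop H K)) (W : set (bop L Q)) : Prop :=
  exists (M1 : set (bop H L)) (M2 : set (bop K Q)),
    [/\ is_sigmaTRO M1, is_sigmaTRO M2,
        X = cspan (bprod (bprod (@adj R K Q @` M2) W) M1)
      & W = cspan (bprod (bprod M2 X) (@adj R H L @` M1))].

Section RiggedModules.
Variables (R : realType) (A : opalgType R) (Y : rightOpModType A).

Definition is_rigging (H K : hilbertType R) (a : {linear A -> bop H H})
    (M : set (bop H K)) (rho : {linear Y -> bop H K}) : Prop :=
  [/\ completely_isometric a /\ (forall x y, a (opmul x y) = a x \bo a y),
      is_sigmaTRO M,
      bprod (bprod (@adj R H K @` M) M) (range a) `<=` range a,
      completely_isometric rho /\ range rho = cspan (bprod M (range a))
    & forall y x, rho (ract y x) = rho y \bo a x].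

Definition doubly_sigmaDelta_rigged : Prop :=
  exists (H K : hilbertType R) (a : {linear A -> bop H H})
    (M : set (bop H K)) (rho : {linear Y -> bop H K}),
    is_rigging a M rho /\
    cspan (bprod (bprod (@adj R H K @` M) M) (range a)) =
    cspan (bprod (range a) (bprod (@adj R H K @` M) M)).

(* The A-valued inner product of the Hilbert module given by a rigging, i.e.
   a^-1 (rho y ^* rho z). *)
Definition rigging_ip (H K : hilbertType R) (a : A -> bop H H)
    (rho : Y -> bop H K) (y z : Y) : A :=
  xget 0 [set x | a x = adj (rho y) \bo rho z].

Definition ip_ideal (ip : Y -> Y -> A) : set A :=
  cspan [set ip y z | y in setT & z in setT].

(* The closed span of the rank one operators x |-> y <z, x>; it consists of
   adjointable operators, the involution being adjoint_wrt ip ip. *)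
Definition compact_ops (ip : Y -> Y -> A) : set (bop Y Y) :=
  cspan [set T : bop Y Y |
    exists y z : Y, forall x : Y, T x = ract y (ip z x)].

End RiggedModules.

(* star turns A into a C*-algebra. The matrix norms of A are then those of this
   C*-algebra: the completely isometric representation provided by opmul_rep is
   a contractive homomorphism, hence a *-homomorphism. *)
Definition is_Cstar_involution (R : realType) (A : opalgType R)
    (star : A -> A) : Prop :=
  [/\ forall (c : R[i]) x y, star (c *: x + y) = Num.conj c *: star x + star y,
      forall x y, star (opmul x y) = opmul (star y) (star x),
      forall x, star (star x) = x
    & forall x, `|opmul (star x) x| = `|x| ^+ 2].

Definition star_isomorphic (R : realType) (U V : normedModType R[i])
    (mulU : U -> U -> U) (starU : U -> U) (S : set U)
    (mulV : V -> V -> V) (starV : V -> V) (T : set V) : Prop :=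
  (forall x, S x -> S (starU x)) /\
  exists f : U -> V,
  [/\ set_bij S T f,
      forall (c : R[i]) x y, S x -> S y -> f (c *: x + y) = c *: f x + f y,
      forall x y, S x -> S y -> f (mulU x y) = mulV (f x) (f y)
    & forall x, S x -> f (starU x) = starV (f x)].

(* Main.v *)
(* Let (a, M, rho) be a doubly rigged representation of Y, and write [ ] for
   closed spans.  Take A0 = [M^* M a(A)], B = [M a(A) M^*] and phi = rho, with
   range [M a(A)].  The double condition lets M^* M and a(A) be interchanged, so
   M implements A0 ~ B, while M^* together with the scalars C 1_K implements
   B ~ phi(Y).  The approximate identities are the iterated limits of
   (\sum_j q_j^* q_j) a(e_t) and of \sum_i p_i a(e_t) p_i^*.

   When A is a C*-algebra, a is a *-homomorphism, because
   |e_t + i s h|^2 <= 1 + s^2 |h|^2 + o(1) for selfadjoint h.  The A-valued inner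
   product does not depend on the rigging: the compressions
   \sum_i p_i a(e_t) p_i^* are contractions of Y with an adjoint from one inner
   product to the other, and log-convexity of the iterates of a positive operator
   gives the inequality between the two inner products in each representation;
   a selfadjoint d of A which is positive in one isometric representation and
   negative in another one is 0.  Then a identifies I_A(Y) with A0, and
   T |-> rho^-1 (T (rho _)) identifies B with the compact operators; this map is
   isometric by the same log-convexity, hence its range is closed. *)
From mathcomp Require Import all_boot all_order all_algebra.
From mathcomp Require Import sesquilinear.
From mathcomp Require Import complex.
From mathcomp Require Import all_classical all_reals all_analysis.
From mathcomp Require Import ring lra.
Require Import Defs.

Set Implicit Arguments.
Unset Strict Implicit.
Unset Printing Implicit Defensive.

Import Order.TTheory GRing.Theory Num.Theory.
Import numFieldNormedType.Exports.

Local Open Scope classical_set_scope.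
Local Open Scope ring_scope.

(** * Real-valued norms *)

(** In the C*-case the rigging of the last clause is arbitrary and bears no relation to the doubly
    rigged one that produces A0 and B. The two inner products can be compared only by inequalities,
    ip' <= ip under one representation and ip <= ip' under the other, and it is not known beforehand
    that the two representations define the same order. The bridge is a condition on norms in A
    alone: with c = |d|, positivity of a selfadjoint d gives |d^2 - c d| <= c^2, whereas for
    negative d the two terms reinforce each other, so that this bound forces d = 0. Square roots and
    spectral theory are avoided: positivity is tested at one well chosen vector, and log-convexity
    of n |-> |S^n xi| turns a bound on exponential growth into a bound at n = 1. A second obstacle
    is degeneracy: a(A)H need not be dense in H. Hence a is first shown to respect adjoints on the
    vectors u with a(e_t) u -> u; the convergence h e_t -> h and weak convergence against such
    vectors cover the rest. *)

Section RealValuedNorm.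
Context {R : realType}.

Section NormedModule.
Variable V : normedModType R[i].
Implicit Types (x y : V) (S : set V).

Lemma rnormN x : rnorm (- x) = rnorm x.
Proof. by rewrite /rnorm normrN. Qed.

Lemma rnormBC x y : rnorm (x - y) = rnorm (y - x).
Proof. by rewrite -rnormN opprB. Qed.

Lemma rnorm_trans z x y : rnorm (x - y) <= rnorm (x - z) + rnorm (z - y).
Proof. by rewrite (le_trans _ (rnormD _ _))// addrA subrK. Qed.

Lemma rnorm_le_sub x y : rnorm x <= rnorm y + rnorm (x - y).
Proof. by rewrite (le_trans _ (rnormD _ _))// addrC subrK. Qed.

Lemma rnorm_lt_eps x : (forall e : R, 0 < e -> rnorm x <= e) -> x = 0.
Proof.
move=> h; apply: rnorm_eq0; apply/eqP; rewrite eq_le rnorm_ge0 andbT.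
by apply/ler_addgt0Pr => e e0; rewrite add0r h.
Qed.

Lemma ballcE x y (e : R) : ball x e%:C%C y = (rnorm (x - y) < e) :> Prop.
Proof. by rewrite -ball_normE /ball_ /= -rnormE ltcR. Qed.

Lemma pos_complexE (e : R[i]) : 0 < e -> e = (complex.Re e)%:C%C /\ 0 < complex.Re e.
Proof.
move=> e0; have eE : (complex.Re e)%:C%C = e by rewrite RRe_real// gtr0_real.
by split; rewrite // -ltcR eE.
Qed.

Lemma nbhs_rnormP x S :
  nbhs x S <-> exists2 e : R, 0 < e & forall y, rnorm (x - y) < e -> S y.
Proof.
rewrite -nbhs_ballE; split=> [[e /= /pos_complexE[-> e0] h]|[e e0 h]].
  by exists (complex.Re e) => // y xy; apply: h; rewrite ballcE.
exists e%:C%C => /=; first by rewrite ltcR.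
by move=> y; rewrite ballcE; apply: h.
Qed.

Lemma closure_rnormP S x :
  closure S x <-> forall e : R, 0 < e -> exists2 y, S y & rnorm (x - y) < e.
Proof.
split=> [cl e e0|h B /nbhs_rnormP[e e0 eB]].
  have [|y [Sy xy]] := cl [set y | rnorm (x - y) < e]; last by exists y.
  by apply/nbhs_rnormP; exists e.
by have [y Sy xy] := h _ e0; exists y; split => //; apply: eB.
Qed.

Lemma closed_rnorm S x : closed S ->
  (forall e : R, 0 < e -> exists2 y, S y & rnorm (x - y) < e) -> S x.
Proof. by move=> cS h; apply/cS/closure_rnormP. Qed.

Lemma closed_rnormW S :
  (forall x, (forall e : R, 0 < e -> exists2 y, S y & rnorm (x - y) < e) -> S x) ->
  closed S.
Proof. by move=> h x /closure_rnormP /h. Qed.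

Lemma cvg_rnormP (T : Type) (F : set_system T) {FF : Filter F} (f : T -> V) x :
  f @ F --> x <-> forall e : R, 0 < e -> \forall t \near F, rnorm (f t - x) < e.
Proof.
split=> [fx e e0|h B /nbhs_rnormP[e e0 eB]].
  apply: (fx [set y | rnorm (y - x) < e]); apply/nbhs_rnormP.
  by exists e => // y; rewrite rnormBC.
have := h _ e0; rewrite /nbhs/=; apply: filterS => t tx; apply: eB.
by rewrite rnormBC.
Qed.

End NormedModule.

(** A bound [r m + r n] is the form in which Cauchy sequences arise below, from minimising sequences
    and from preimages of points approaching a limit. *)
Lemma cvg_seq_rnorm (V : completeNormedModType R[i]) (u : nat -> V)
    (r : nat -> R) : (r @ \oo --> (0 : R)) ->
  (forall m n, rnorm (u m - u n) <= r m + r n) -> cvgn u.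
Proof.
move=> r0 ur; apply/cauchy_cvgP/cauchy_exP => e /pos_complexE[-> e0].
have rlt : \forall n \near \oo, r n < complex.Re e / 2.
  by apply: (cvgr_lt 0) => //; exact: divr_gt0.
have [N _ rN] := rlt; exists (u N); exists N => // n /= Nn.
rewrite ballcE (le_lt_trans (ur _ _))// [ltRHS]splitr ltrD ?rN//=.
Qed.

End RealValuedNorm.

Arguments cvg_rnormP {R V T F FF f x}.
Arguments closure_rnormP {R V S x}.

(** * Riesz representation *)

Section RealInnerProduct.
Context {R : realType}.

Lemma ReD (x y : R[i]) : complex.Re (x + y) = complex.Re x + complex.Re y.
Proof. by case: x y => [? ?] []. Qed.

Lemma ReN (x : R[i]) : complex.Re (- x) = - complex.Re x.
Proof. by case: x. Qed.

Lemma ReZ (r : R) (x : R[i]) : complex.Re (r%:C%C * x) = r * complex.Re x.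
Proof. by case: x => a b /=; rewrite mul0r subr0. Qed.

Lemma Re_conj (x : R[i]) : complex.Re (Num.conj x) = complex.Re x.
Proof. by case: x. Qed.

Lemma Re_conji (x : R[i]) : complex.Re (Num.conj 'i%C * x) = complex.Im x.
Proof. by case: x => a b /=; ring. Qed.

Lemma conj_i : Num.conj 'i%C = - 'i%C :> R[i].
Proof. by apply/eqP; rewrite eq_complex /=; apply/andP; split; apply/eqP; ring. Qed.

Variable H : hilbertType R.
Implicit Types x y z : H.

(** The real part keeps every estimate in the ordered field [R]; multiplying an argument by i
    recovers the imaginary part, as in [hdot_ext]. *)
Definition rdot x y : R := complex.Re (hdot x y).

Lemma hdotC x y : hdot x y = Num.conj (hdot y x).
Proof. by rewrite hermC expr0 mul1r. Qed.

Lemma rdotC x y : rdot x y = rdot y x.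
Proof. by rewrite /rdot hdotC Re_conj. Qed.

Lemma rdotDl x y z : rdot (x + y) z = rdot x z + rdot y z.
Proof. by rewrite /rdot linearDl ReD. Qed.

Lemma rdotDr x y z : rdot x (y + z) = rdot x y + rdot x z.
Proof. by rewrite !(rdotC x) rdotDl. Qed.

Lemma rdotNl x y : rdot (- x) y = - rdot x y.
Proof. by rewrite /rdot linearNl ReN. Qed.

Lemma rdotNr x y : rdot x (- y) = - rdot x y.
Proof. by rewrite !(rdotC x) rdotNl. Qed.

Lemma rdotBl x y z : rdot (x - y) z = rdot x z - rdot y z.
Proof. by rewrite rdotDl rdotNl. Qed.

Lemma rdotBr x y z : rdot x (y - z) = rdot x y - rdot x z.
Proof. by rewrite rdotDr rdotNr. Qed.

Lemma rdotZl (r : R) x y : rdot (r%:C%C *: x) y = r * rdot x y.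
Proof. by rewrite /rdot linearZl_LR /= ReZ. Qed.

Lemma rdotZr (r : R) x y : rdot x (r%:C%C *: y) = r * rdot x y.
Proof. by rewrite !(rdotC x) rdotZl. Qed.

Lemma rdot_suml n (f : 'I_n -> H) y : rdot (\sum_i f i) y = \sum_i rdot (f i) y.
Proof.
elim/big_rec2 : _ => [|i r s _ <-]; last by rewrite rdotDl.
by rewrite /rdot linear0l.
Qed.

Lemma rdotE x : rdot x x = rnorm x ^+ 2.
Proof. by rewrite /rdot hdotE -rnormE -rmorphXn. Qed.

Lemma rdot_ext y z : (forall x, rdot x y = rdot x z) -> y = z.
Proof.
move=> h; apply/eqP; rewrite -subr_eq0; apply/eqP/rnorm_eq0/eqP.
by rewrite -sqrf_eq0 -rdotE rdotBr h subrr.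
Qed.

Lemma hdot_ext x y (c : R[i]) :
  (forall d : R[i], rdot (d *: x) y = complex.Re (d * c)) -> hdot x y = c.
Proof.
move=> h; have := h 1; have := h (Num.conj 'i%C).
rewrite /rdot !linearZl_LR /= !Re_conji !mul1r => hi h1.
by apply/eqP; rewrite eq_complex hi h1 !eqxx.
Qed.

Lemma rdot_le x y : rdot x y <= rnorm x * rnorm y.
Proof.
have [->|y0] := eqVneq y 0; first by rewrite rnorm0 mulr0 /rdot linear0r.
have ny : 0 < rnorm y.
  by rewrite lt_neqAle rnorm_ge0 andbT eq_sym; apply: contra_neq y0 => /rnorm_eq0.
rewrite -[leLHS]mulr1; set r := rdot x y.
have : 0 <= rdot ((rnorm y ^+ 2)%:C%C *: x - r%:C%C *: y)
                ((rnorm y ^+ 2)%:C%C *: x - r%:C%C *: y).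
  by rewrite rdotE sqr_ge0.
rewrite !(rdotBl, rdotBr, rdotZl, rdotZr) (rdotC y x) -/r !rdotE.
move=> h; have {h} : 0 <= rnorm y ^+ 2 * ((rnorm x * rnorm y) ^+ 2 - r ^+ 2) by lra.
rewrite pmulr_rge0 ?exprn_gt0// subr_ge0 mulr1 => h.
have [r0|r0] := leP r 0; first by rewrite (le_trans r0)// mulr_ge0// rnorm_ge0.
by rewrite -(@ler_pXn2r _ 2)// ?nnegrE ?mulr_ge0 ?rnorm_ge0 ?(ltW r0).
Qed.

Lemma rnorm_le_rdot x (C : R) : 0 <= C ->
  (forall y, rdot x y <= C * rnorm y) -> rnorm x <= C.
Proof.
move=> C0 /(_ x); rewrite rdotE expr2 => h.
have [->//|x0] := eqVneq (rnorm x) 0.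
by rewrite -(@ler_pM2r _ (rnorm x))// lt_neqAle eq_sym x0 rnorm_ge0.
Qed.

Lemma rnorm_sqrD x y : rnorm (x + y) ^+ 2 = rnorm x ^+ 2 + 2 * rdot x y + rnorm y ^+ 2.
Proof. by rewrite -!rdotE rdotDl !rdotDr (rdotC y x); ring. Qed.

Lemma norm_hdot_le x y : complex.Re `|hdot x y| <= rnorm x * rnorm y.
Proof.
set z := hdot x y; have [->|z0] := eqVneq z 0.
  by rewrite normr0 mulr_ge0 ?rnorm_ge0.
have n0 : `|z| != 0 by rewrite normr_eq0.
pose c := Num.conj z / `|z|.
have cz : c * z = `|z| by rewrite /c mulrAC -normCKC expr2 mulfK.
have c1 : `|c| = 1 by rewrite /c normf_div norm_conjC normr_id divff.
have := rdot_le (c *: x) y.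
by rewrite /rdot linearZl_LR /= -/z cz rnormZ c1 /= mul1r.
Qed.

(* Minimising J x = |x|^2 - 2 Re (phi x): the parallelogram identity
   J x + J y - 2 J ((x+y)/2) = |x - y|^2 / 2 makes minimising sequences Cauchy. *)
Lemma riesz_representation (phi : H -> R[i]) (C : R) :
  (forall c x y, phi (c *: x + y) = c * phi x + phi y) ->
  (forall x, complex.Re (phi x) <= C * rnorm x) ->
  exists z, forall x, phi x = hdot x z.
Proof.
move=> phiL phiC.
pose f x := complex.Re (phi x).
have phi0 : phi 0 = 0.
  by have := phiL (-1) 0 0; rewrite scaler0 addr0 mulN1r addNr.
have phiZ c x : phi (c *: x) = c * phi x.
  by have := phiL c x 0; rewrite !addr0 phi0 addr0.
have phiD x y : phi (x + y) = phi x + phi y.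
  by have := phiL 1 x y; rewrite scale1r mul1r.
have fD x y : f (x + y) = f x + f y by rewrite /f phiD ReD.
have fZ (r : R) x : f (r%:C%C *: x) = r * f x by rewrite /f phiZ ReZ.
pose J x := rnorm x ^+ 2 - 2 * f x.
have Jlb x : - C ^+ 2 <= J x.
  have : 0 <= (rnorm x - C) ^+ 2 by rewrite sqr_ge0.
  by have := phiC x; rewrite /J -/(f x); lra.
pose E := [set J x | x in setT].
have infE : has_inf E.
  by split; [exists (J 0), 0 | exists (- C ^+ 2) => _ [x _ <-]].
have Jge x : inf E <= J x by apply: ge_inf; [exact: infE.2 | exists x].
have par x y : rnorm (x - y) ^+ 2 <= 2 * (J x - inf E) + 2 * (J y - inf E).
  have := Jge ((2^-1)%:C%C *: (x + y)).
  rewrite /J fZ fD -!rdotE !(rdotBl, rdotBr, rdotZl, rdotZr, rdotDl, rdotDr).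
  by rewrite (rdotC y x); lra.
(* With this excess over the infimum, [par] bounds |u_m - u_n|^2 by half the sum of the squares of
   1/(m+1) and 1/(n+1), hence |u_m - u_n| by their sum. *)
have ex (n : nat) : exists x, J x < inf E + n.+1%:R^-1 ^+ 2 / 4.
  have [|_ [x _ <-] h] := @inf_adherent _ E (n.+1%:R^-1 ^+ 2 / 4) _ infE; last by exists x.
  by rewrite divr_gt0// exprn_gt0// invr_gt0 ltr0n.
have [u uJ] := choice ex.
have uc : cvgn u.
  apply: (@cvg_seq_rnorm _ _ _ (fun n => n.+1%:R^-1)) => [|m n].
    exact: cvg_harmonic.
  have p0 k : 0 < k.+1%:R^-1 :> R by rewrite invr_gt0 ltr0n.
  have p0' k := ltW (p0 k).
  rewrite -(@ler_pXn2r _ 2)// ?nnegrE ?rnorm_ge0 ?addr_ge0//.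
  apply: (le_trans (par _ _)).
  have := uJ m; have := uJ n; have := p0 m; have := p0 n.
  by move: (n.+1%:R^-1 : R) (m.+1%:R^-1 : R) => a b; nra.
have [z uz] : exists z, u @ \oo --> z by exists (limn u).
have fub x : `|f x| <= `|C| * rnorm x.
  have h y : f y <= `|C| * rnorm y.
    by rewrite (le_trans (phiC y))// ler_wpM2r ?rnorm_ge0// ler_norm.
  rewrite ler_norml h andbT lerNl -mulN1r.
  have := h ((-1)%:C%C *: x); rewrite fZ rnormZ.
  by rewrite rmorphN1 normrN1 /= mul1r.
have Jz : J z = inf E.
  apply/eqP; rewrite eq_le Jge andbT; apply/ler_addgt0Pr => e e0.
  pose K := 2 * rnorm z + 1 + 2 * `|C|.
  have K0 : 0 < K by rewrite /K; have := rnorm_ge0 z; have := normr_ge0 C; lra.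
  have d0 : 0 < Num.min 1 (e / 2 / K).
    by rewrite lt_min ltr01 divr_gt0// divr_gt0.
  have h1 : \forall n \near \oo, rnorm (u n - z) < Num.min 1 (e / 2 / K).
    exact: cvg_rnormP.1 uz _ d0.
  have h2 : \forall n \near \oo, n.+1%:R^-1 < Num.min 1 (e / 2) :> R.
    apply: (cvgr_lt 0); first exact: cvg_harmonic.
    by rewrite lt_min ltr01 divr_gt0.
  have [n [n1 n2]] := filter_ex (filterI h1 h2).
  have := uJ n; move: n1 n2; rewrite !lt_min => /andP[a1 a2] /andP[b1 b2].
  have := fub (u n - z); have -> : f (u n - z) = f (u n) - f z.
    by rewrite -[in LHS]scaleN1r fD -(rmorphN1 (real_complex R)) fZ mulN1r.
  have b0 : 0 < n.+1%:R^-1 :> R by rewrite invr_gt0 ltr0n.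
  have := rnorm_le_sub z (u n); rewrite rnormBC.
  rewrite ltr_pdivlMr// in a2.
  move: (rnorm_ge0 z) (rnorm_ge0 (u n)) (rnorm_ge0 (u n - z)) (normr_ge0 C).
  rewrite ler_norml /J /K in a2 *.
  move: (n.+1%:R^-1 : R) b1 b2 b0 => s b1 b2 b0.
  move=> hz hu hd hC h3 /andP[h4 h5] h6.
  have h7 : rnorm z ^+ 2 <= rnorm (u n) ^+ 2 + 2 * rnorm (u n - z) * rnorm z.
    case: (leP (rnorm (u n - z)) (rnorm z)) => hzd; last by nra.
    have : (rnorm z - rnorm (u n - z)) ^+ 2 <= rnorm (u n) ^+ 2.
      by rewrite ler_sqr ?nnegrE ?subr_ge0// lerBlDr.
    by have := sqr_ge0 (rnorm (u n - z)); lra.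
  have h8 : s ^+ 2 <= s by nra.
  by nra.
exists z => v; apply/esym/hdot_ext => d.
rewrite -phiZ -/(f _); move: (d *: v) => w {v d}.
have hJ t : 0 <= t * (2 * (rdot w z - f w)) + t ^+ 2 * rnorm w ^+ 2.
  have := Jge (z + t%:C%C *: w); rewrite -Jz /J fD fZ -!rdotE.
  by rewrite !(rdotDl, rdotDr, rdotZl, rdotZr) (rdotC z w); lra.
apply/eqP; rewrite -subr_eq0; apply/eqP; set b := rdot w z - f w in hJ *.
have w0 := sqr_ge0 (rnorm w).
(* Almost the minimiser of the quadratic in t; 1 + |w|^2 in place of |w|^2 avoids a separate case w
   = 0. *)
have hh := hJ (- b / (1 + rnorm w ^+ 2)).
have : 0 <= - b ^+ 2 *(2 + rnorm w ^+ 2).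
  have /mulr_ge0 := hh => /(_ ((1 + rnorm w ^+ 2) ^+ 2)).
  have -> : (- b / (1 + rnorm w ^+ 2) * (2 * b) + (- b / (1 + rnorm w ^+ 2)) ^+ 2 *
     rnorm w ^+ 2) * (1 + rnorm w ^+ 2) ^+ 2 = - b ^+ 2 * (2 + rnorm w ^+ 2).
    have : 1 + rnorm w ^+ 2 != 0 by rewrite gt_eqF// ltr_wpDr.
    by move=> ?; field.
  by apply; rewrite sqr_ge0.
move=> h; have : b ^+ 2 <= 0 by nra.
by move=> b2; apply/eqP; rewrite -sqrf_eq0 eq_le b2 sqr_ge0.
Qed.

End RealInnerProduct.

(** * Bounded operators and adjoints *)

Section BoundedOperatorTheory.
Context {R : realType}.

Lemma rnorm_le1 (V : normedModType R[i]) (x : V) : (rnorm x <= 1) = (`|x| <= 1).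
Proof. by rewrite le_rnorm. Qed.

Section Norm.
Variables V W : normedModType R[i].
Implicit Types f g : bop V W.

Lemma bop_ext f g : (forall x, f x = g x) -> f = g.
Proof. by move=> fg; apply/val_inj/funext. Qed.

Lemma rnorm_app f x : rnorm (f x) <= rnorm f * rnorm x.
Proof. exact: opnorm_ubR. Qed.

Lemma rnorm_app_le f x (C : R) : rnorm f <= C -> rnorm (f x) <= C * rnorm x.
Proof. by move=> fC; rewrite (le_trans (rnorm_app _ _))// ler_wpM2r ?rnorm_ge0. Qed.

Lemma rnorm_bop_le f (C : R) : 0 <= C ->
  (forall x, rnorm (f x) <= C * rnorm x) -> rnorm f <= C.
Proof. by move=> C0 h; rewrite le_rnorm; exact: opnorm_le. Qed.

Lemma bop_sumE n (f : 'I_n -> bop V W) x : (\sum_i f i) x = \sum_i f i x.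
Proof. by elim/big_rec2 : _ => // i y1 y2 _ <-. Qed.

Lemma mkbop (f : V -> W) (C : R) :
  (forall (c : R[i]) x y, f (c *: x + y) = c *: f x + f y) ->
  (forall x, rnorm (f x) <= C * rnorm x) ->
  exists T : bop V W, forall x, T x = f x.
Proof.
move=> fL fC; suff fb : f \in @bounded_op R V W by exists (Bop fb).
by apply/bounded_opP; split; [move=> c x y; exact: fL | exists C].
Qed.

End Norm.

Section Composition.
Variables U V W X : normedModType R[i].
Implicit Types (S : bop V W) (T : bop U V).

Lemma bcompA (Q : bop W X) S T : Q \bo (S \bo T) = Q \bo S \bo T.
Proof. exact: bop_ext. Qed.

Lemma bcompDl S1 S2 T : (S1 + S2) \bo T = S1 \bo T + S2 \bo T.
Proof. exact: bop_ext. Qed.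

Lemma bcompDr S T1 T2 : S \bo (T1 + T2) = S \bo T1 + S \bo T2.
Proof. by apply: bop_ext => x; exact: linearD. Qed.

Lemma bcompNl S T : (- S) \bo T = - (S \bo T).
Proof. exact: bop_ext. Qed.

Lemma bcompNr S T : S \bo (- T) = - (S \bo T).
Proof. by apply: bop_ext => x; exact: linearN. Qed.

Lemma bcompBl S1 S2 T : (S1 - S2) \bo T = S1 \bo T - S2 \bo T.
Proof. by rewrite bcompDl bcompNl. Qed.

Lemma bcompBr S T1 T2 : S \bo (T1 - T2) = S \bo T1 - S \bo T2.
Proof. by rewrite bcompDr bcompNr. Qed.

Lemma bcompZl c S T : (c *: S) \bo T = c *: (S \bo T).
Proof. exact: bop_ext. Qed.

Lemma bcompZr c S T : S \bo (c *: T) = c *: (S \bo T).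
Proof. by apply: bop_ext => x; exact: linearZ. Qed.

Lemma bcomp0l T : (0 : bop V W) \bo T = 0.
Proof. exact: bop_ext. Qed.

Lemma bcomp0r S : S \bo (0 : bop U V) = 0.
Proof. by apply: bop_ext => x; exact: linear0. Qed.

Lemma bcomp_suml n (f : 'I_n -> bop V W) T :
  (\sum_i f i) \bo T = \sum_i (f i \bo T).
Proof. by elim/big_rec2 : _ => [|i y1 y2 _ <-]; rewrite ?bcomp0l ?bcompDl. Qed.

Lemma bcomp_sumr n (f : 'I_n -> bop U V) S :
  S \bo (\sum_i f i) = \sum_i (S \bo f i).
Proof. by elim/big_rec2 : _ => [|i y1 y2 _ <-]; rewrite ?bcomp0r ?bcompDr. Qed.

Lemma rnorm_bcomp S T : rnorm (S \bo T) <= rnorm S * rnorm T.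
Proof.
apply: rnorm_bop_le => [|x]; first by rewrite mulr_ge0 ?rnorm_ge0.
by rewrite (le_trans (rnorm_app S (T x)))// -mulrA ler_wpM2l ?rnorm_ge0 ?rnorm_app.
Qed.

Lemma rnorm_bcomp_le S T (C : R) : rnorm S <= C -> rnorm (S \bo T) <= C * rnorm T.
Proof. by move=> h; rewrite (le_trans (rnorm_bcomp _ _))// ler_wpM2r ?rnorm_ge0. Qed.

Lemma rnorm_bcomp_le1l S T : rnorm S <= 1 -> rnorm (S \bo T) <= rnorm T.
Proof. by move/(rnorm_bcomp_le T); rewrite mul1r. Qed.

Lemma rnorm_bcomp_le1r S T : rnorm T <= 1 -> rnorm (S \bo T) <= rnorm S.
Proof.
move=> h; rewrite (le_trans (rnorm_bcomp _ _))// -[leRHS]mulr1.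
by rewrite ler_wpM2l ?rnorm_ge0.
Qed.

End Composition.

Lemma bid_subproof (V : normedModType R[i]) : @id V \in @bounded_op R V V.
Proof. by apply/bounded_opP; split=> //; exists 1 => x; rewrite mul1r. Qed.

Definition bid (V : normedModType R[i]) : bop V V := Bop (bid_subproof V).

Lemma bid_comp (V W : normedModType R[i]) (T : bop V W) : bid W \bo T = T.
Proof. exact: bop_ext. Qed.

Lemma comp_bid (V W : normedModType R[i]) (T : bop V W) : T \bo bid V = T.
Proof. exact: bop_ext. Qed.

Section Adjoint.
Variables H K : hilbertType R.
Implicit Types S T : bop H K.

(** [adj] is a choice with default 0, so this rests on the existence of an adjoint: Riesz supplies
    its values, and linearity and the bound come from pairing them with arbitrary vectors. *)
Lemma adjE T x y : hdot (T x) y = hdot x (adj T y).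
Proof.
suff [S TS] : exists S : bop K H, forall x y, hdot (T x) y = hdot x (S y).
  rewrite /adj /adjoint_wrt; case: xgetP => [S' _ /(_ x y)//|/(_ S)].
  by move/(_ TS).
have ex z : exists w, forall x, hdot (T x) z = hdot x w.
  apply: (@riesz_representation _ _ _ (rnorm T * rnorm z)) => [c u v|u].
    by rewrite linearP linearDl linearZl_LR.
  rewrite (le_trans (rdot_le _ _))// mulrAC ler_wpM2r ?rnorm_ge0//.
  exact: rnorm_app.
have [f fE] := choice ex.
have [|u|S SE] := @mkbop _ _ f (rnorm T); last by exists S => u v; rewrite SE.
  move=> c u v; apply: rdot_ext => w.
  rewrite rdotDr /rdot -fE linearDr /= [hdot (T w) (c *: u)]hdotC.
  by rewrite [hdot w (c *: _)]hdotC !linearZl_LR /= !rmorphM /= -!hdotC -!fE ReD.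
apply: rnorm_le_rdot => [|w]; first by rewrite mulr_ge0 ?rnorm_ge0.
rewrite rdotC /rdot -fE (le_trans (rdot_le _ _))//.
by rewrite mulrAC ler_wpM2r ?rnorm_ge0 ?rnorm_app.
Qed.

Lemma radjE T x y : rdot (T x) y = rdot x (adj T y).
Proof. by rewrite /rdot adjE. Qed.

Lemma adj_uniq T (S : bop K H) :
  (forall x y, rdot (T x) y = rdot x (S y)) -> adj T = S.
Proof. by move=> h; apply: bop_ext => y; apply: rdot_ext => x; rewrite -radjE. Qed.

Lemma adj0 : adj (0 : bop H K) = 0.
Proof. by apply: adj_uniq => x y; rewrite /rdot linear0l linear0r. Qed.

Lemma adjD S T : adj (S + T) = adj S + adj T.
Proof. by apply: adj_uniq => x y; rewrite rdotDl rdotDr !radjE. Qed.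

Lemma adjZ c T : adj (c *: T) = Num.conj c *: adj T.
Proof.
apply: adj_uniq => x y; rewrite /rdot linearZl_LR /= adjE.
by rewrite [RHS]/= [in RHS]hdotC linearZl_LR /= rmorphM /= conjCK -hdotC.
Qed.

Lemma adjN T : adj (- T) = - adj T.
Proof. by apply: adj_uniq => x y; rewrite rdotNl rdotNr radjE. Qed.

Lemma adjB S T : adj (S - T) = adj S - adj T.
Proof. by rewrite adjD adjN. Qed.

Lemma adj_sum n (f : 'I_n -> bop H K) : adj (\sum_i f i) = \sum_i adj (f i).
Proof. by elim/big_rec2 : _ => [|i y1 y2 _ <-]; rewrite ?adj0 ?adjD. Qed.

End Adjoint.

Section AdjointNorm.
Variables H K L : hilbertType R.
Implicit Types T : bop H K.

Lemma adjK T : adj (adj T) = T.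
Proof. by apply: adj_uniq => x y; rewrite rdotC -radjE rdotC. Qed.

Lemma adj_comp (S : bop K L) T : adj (S \bo T) = adj T \bo adj S.
Proof. by apply: adj_uniq => x y; rewrite (radjE S) (radjE T). Qed.

Lemma adj_bid : adj (bid H) = bid H.
Proof. exact: adj_uniq. Qed.

Lemma rnorm_adj_comp T : rnorm (adj T \bo T) = rnorm T ^+ 2.
Proof.
have adj_le (X Y : hilbertType R) (S : bop X Y) : rnorm (adj S) <= rnorm S.
  apply: rnorm_bop_le => [|y]; first exact: rnorm_ge0.
  apply: rnorm_le_rdot => [|x]; first by rewrite mulr_ge0 ?rnorm_ge0.
  rewrite rdotC -radjE (le_trans (rdot_le _ _))// mulrAC ler_wpM2r ?rnorm_ge0//.
  exact: rnorm_app.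
apply/eqP; rewrite eq_le; apply/andP; split.
  by rewrite (le_trans (rnorm_bcomp _ _))// expr2 ler_wpM2r ?rnorm_ge0.
rewrite -[leRHS]sqr_sqrtr ?rnorm_ge0// ler_sqr ?nnegrE ?rnorm_ge0 ?sqrtr_ge0//.
apply: rnorm_bop_le => [|x]; first exact: sqrtr_ge0.
rewrite -ler_sqr ?nnegrE ?mulr_ge0 ?rnorm_ge0 ?sqrtr_ge0//.
rewrite exprMn sqr_sqrtr ?rnorm_ge0// -rdotE radjE rdotC.
rewrite (le_trans (rdot_le _ _))// expr2 mulrA ler_wpM2r ?rnorm_ge0//.
exact: (rnorm_app (adj T \bo T)).
Qed.

End AdjointNorm.

Lemma rnorm_adj (H K : hilbertType R) (T : bop H K) : rnorm (adj T) = rnorm T.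
Proof.
suff adj_le (X Y : hilbertType R) (S : bop X Y) : rnorm S <= rnorm (adj S).
  by apply/eqP; rewrite eq_le adj_le andbT -{2}(adjK T) adj_le.
have := rnorm_adj_comp S; have := rnorm_bcomp (adj S) S.
have := rnorm_ge0 S; have := rnorm_ge0 (adj S).
by move: (rnorm S) (rnorm (adj S)) => s t t0 s0 + e; rewrite e; nra.
Qed.

(** Matrix norms and the norm are tied together only through the representation [j], so the 1 x 1
    case is read off there. This is how complete isometries become isometries below. *)
Lemma mxnorm1 (V : opspaceType R) (v : V) : mxnorm 1 (const_mx v) = rnorm v.
Proof.
have [H [K [j [jI ->]]]] := @mxnorm_rep R V.
rewrite /rnorm -jI /=; congr sup; apply/seteqP; split=> [_ [x x1 <-]|_ [x /= x1 <-]].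
  exists (x ord0); last by rewrite !big_ord1 !mxE sqrtr_sqr ger0_norm ?rnorm_ge0.
  by move: x1; rewrite /= big_ord1 -rnorm_le1 expr_le1 ?rnorm_ge0.
exists (fun=> x); last by rewrite !big_ord1 !mxE sqrtr_sqr ger0_norm ?rnorm_ge0.
by rewrite /= big_ord1 expr_le1 ?rnorm_ge0// rnorm_le1.
Qed.

Lemma completely_isometric_rnorm (V W : opspaceType R) (f : V -> W) :
  completely_isometric f -> forall v, rnorm (f v) = rnorm v.
Proof.
by move=> fI v; rewrite -!mxnorm1 -(fI _ (const_mx v)) map_const_mx.
Qed.

End BoundedOperatorTheory.

(** * Closed spans *)

Section ClosedSubspaces.
Context {R : realType}.

Definition closed_subspace (V : normedModType R[i]) (S : set V) : Prop :=
  linear_subspace S /\ closed S.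

Section Theory.
Variable V : normedModType R[i].
Implicit Types (S C : set V) (x y : V).

Lemma subspaceD S x y : linear_subspace S -> S x -> S y -> S (x + y).
Proof. by move=> [_ h] Sx Sy; have := h 1 _ _ Sx Sy; rewrite scale1r. Qed.

Lemma subspaceZ S c x : linear_subspace S -> S x -> S (c *: x).
Proof. by move=> [S0 h] Sx; have := h c _ _ Sx S0; rewrite addr0. Qed.

Lemma subspaceB S x y : linear_subspace S -> S x -> S y -> S (x - y).
Proof.
by move=> Sl Sx Sy; apply: subspaceD => //; rewrite -scaleN1r; apply: subspaceZ.
Qed.

Lemma subspace_sum S n (f : 'I_n -> V) :
  linear_subspace S -> (forall i, S (f i)) -> S (\sum_i f i).
Proof.
by move=> Sl Sf; elim/big_rec : _ => [|i x _ Sx]; [case: Sl | exact: subspaceD].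
Qed.

Lemma sub_lspan S : S `<=` lspan S.
Proof. by move=> x Sx; exists 1%N, (fun=> 1), (fun=> x); rewrite big_ord1 scale1r. Qed.

Lemma lspan_min S C : linear_subspace C -> S `<=` C -> lspan S `<=` C.
Proof.
move=> Cl SC _ [n [c [s [Ss ->]]]]; apply: subspace_sum => // i.
by apply: subspaceZ => //; apply: SC.
Qed.

Lemma lspan_subspace S : linear_subspace (lspan S).
Proof.
split=> [|c _ _ [n [d [s [Ss ->]]]] [m [e [t [St ->]]]]].
  by exists 0%N, (fun=> 0), (fun=> 0); split=> [[]//|]; rewrite big_ord0.
exists (n + m)%N, (fun i => match fintype.split i with inl j => c * d j | inr j => e j end),
  (fun i => match fintype.split i with inl j => s j | inr j => t j end).
split=> [i|]; first by case: fintype.split.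
rewrite big_split_ord/=; congr (_ + _).
  rewrite scaler_sumr; apply: eq_bigr => i _.
  by have := unsplitK (inl i : 'I_n + 'I_m) => /= ->; rewrite scalerA.
by apply: eq_bigr => i _; have := unsplitK (inr i : 'I_n + 'I_m) => /= ->.
Qed.

Lemma closure_subspace S : linear_subspace S -> linear_subspace (closure S).
Proof.
move=> [S0 h]; split; first exact: subset_closure.
move=> c x y /closure_rnormP Sx /closure_rnormP Sy; apply/closure_rnormP => e e0.
pose k := 1 + complex.Re `|c|.
have c0 : 0 <= complex.Re `|c| by rewrite -ler0c RRe_real.
have k0 : 0 < k by rewrite /k ltr_pwDl.
have [|x' Sx' xx'] := Sx (e / 2 / k); first by rewrite !divr_gt0.
have [|y' Sy' yy'] := Sy (e / 2); first by rewrite divr_gt0.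
exists (c *: x' + y'); first exact: h.
rewrite opprD addrACA -scalerBr (le_lt_trans (rnormD _ _))// [ltRHS]splitr.
rewrite ler_ltD// rnormZ (@le_trans _ _ (k * rnorm (x - x')))//.
  by rewrite ler_wpM2r ?rnorm_ge0// /k lerDr.
by rewrite mulrC -ler_pdivlMr// ltW.
Qed.

Lemma cspan_closed_subspace S : closed_subspace (cspan S).
Proof. by split; [exact/closure_subspace/lspan_subspace | exact: closed_closure]. Qed.

Lemma sub_cspan S : S `<=` cspan S.
Proof. by move=> x /sub_lspan; exact: subset_closure. Qed.

Lemma cspan_min S C : closed_subspace C -> S `<=` C -> cspan S `<=` C.
Proof.
move=> [Cl /closure_id CC] SC; rewrite CC; apply: closure_subset.
exact: lspan_min.
Qed.

Lemma closed_subspace_cvg S (T : Type) (F : set_system T) {FF : ProperFilter F}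
  (f : T -> V) x : closed_subspace S -> (forall t, S (f t)) -> f @ F --> x -> S x.
Proof.
move=> [_ cS] Sf fx; apply: closed_rnorm => // e e0.
have h : \forall t \near F, rnorm (f t - x) < e by exact: cvg_rnormP.1 fx e e0.
by have [t] := filter_ex h; exists (f t) => //; rewrite rnormBC.
Qed.

(* With g the conjugation this also covers T |-> adj T. *)
Lemma closed_subspace_preimage (W : normedModType R[i]) (g : R[i] -> R[i])
    (f : V -> W) (C : set W) (k : R) :
  (forall c x y, f (c *: x + y) = g c *: f x + f y) ->
  (forall x, rnorm (f x) <= k * rnorm x) ->
  closed_subspace C -> closed_subspace (f @^-1` C).
Proof.
move=> fl fk [Cl Cc].
have f0 : f 0 = 0.
  by apply: rnorm_eq0; apply/eqP; rewrite eq_le rnorm_ge0 (le_trans (fk _))// rnorm0 mulr0.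
have g1 z : g 1 *: f z = f z by have := fl 1 z 0; rewrite scale1r !addr0 f0 addr0.
have fD x y : f (x + y) = f x + f y by rewrite -[in LHS](scale1r x) fl g1.
have fB x y : f (x - y) = f x - f y.
  by rewrite fD; congr (_ + _); apply/eqP; rewrite -addr_eq0 -fD addNr f0.
split; first by split=> [|c x y Cx Cy]; rewrite /= ?f0 ?fl; [exact: Cl.1 | exact: Cl.2].
apply: closed_rnormW => x h; apply: closed_rnorm Cc _ => e e0.
have k0 : 0 < 1 + `|k| by rewrite ltr_pwDl.
have [|y Cy xy] := h (e / (1 + `|k|)); first by rewrite divr_gt0.
exists (f y) => //; rewrite -fB (le_lt_trans (fk _))//.
move: xy; rewrite ltr_pdivlMr// => xy; apply: le_lt_trans xy.
by rewrite mulrC ler_wpM2l ?rnorm_ge0// (le_trans (ler_norm _))// lerDr.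
Qed.

(** A three-epsilon argument, in which uniform contractivity gives closedness. It reduces the
    convergence of an approximate identity to generators of a closed span. *)
Lemma closed_subspace_approx_unit (T : Type) (F : set_system T)
    {FF : Filter F} (Phi : T -> V -> V) :
  (forall t c x y, Phi t (c *: x + y) = c *: Phi t x + Phi t y) ->
  (forall t x, rnorm (Phi t x) <= rnorm x) ->
  closed_subspace [set x | Phi t x @[t --> F] --> x].
Proof.
move=> Pl P1.
have P0 t : Phi t 0 = 0.
  by apply: rnorm_eq0; apply/eqP; rewrite eq_le rnorm_ge0 (le_trans (P1 _ _))// rnorm0.
have PB t x y : Phi t (x - y) = Phi t x - Phi t y.
  by rewrite addrC -scaleN1r Pl scaleN1r addrC.
split.
  split=> /= [|c x y hx hy].
    by apply/cvg_rnormP => e e0; near=> t; rewrite P0 subrr rnorm0.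
  rewrite (_ : (fun t => _) = (fun t => c *: Phi t x + Phi t y)); last exact/funext.
  by apply: cvgD => //; apply: cvgZr.
apply: closed_rnormW => x h; apply/cvg_rnormP => e e0.
have [|y /= hy xy] := h (e / 3); first by rewrite divr_gt0.
have hy' : \forall t \near F, rnorm (Phi t y - y) < e / 3.
  by apply: cvg_rnormP.1 hy _ _; rewrite divr_gt0.
near=> t; have ht : rnorm (Phi t y - y) < e / 3 by near: t.
have -> : Phi t x - x = Phi t (x - y) + (Phi t y - y) + (y - x).
  by rewrite PB !addrA !subrK.
rewrite (le_lt_trans (rnormD _ _))// (le_lt_trans (lerD (rnormD _ _) (lexx _)))//.
have := P1 t (x - y); rewrite (rnormBC y x); lra.
Unshelve. all: by end_near. Qed.

End Theory.

Section Operators.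
Variables H K L : hilbertType R.

(** Together with [cspan_min], such preimages serve as induction predicates: a property of a whole
    closed span is checked on products. *)
Lemma closed_subspace_compl (S : bop K L) (C : set (bop H L)) :
  closed_subspace C -> closed_subspace [set T : bop H K | C (S \bo T)].
Proof.
apply: (@closed_subspace_preimage _ _ id (fun T => S \bo T) _ (rnorm S)) => [c x y|x].
  by rewrite bcompDr bcompZr.
exact: rnorm_bcomp.
Qed.

Lemma closed_subspace_compr (T : bop H K) (C : set (bop H L)) :
  closed_subspace C -> closed_subspace [set S : bop K L | C (S \bo T)].
Proof.
apply: (@closed_subspace_preimage _ _ id (fun S => S \bo T) _ (rnorm T)) => [c x y|x].
  by rewrite bcompDl bcompZl.
by rewrite mulrC rnorm_bcomp.
Qed.

Lemma closed_subspace_adj (C : set (bop K H)) :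
  closed_subspace C -> closed_subspace [set T : bop H K | C (adj T)].
Proof.
apply: (@closed_subspace_preimage _ _ Num.conj (@adj R H K) _ 1) => [c x y|x].
  by rewrite adjD adjZ.
by rewrite rnorm_adj mul1r.
Qed.

Lemma mem_cspan_bprod (X : set (bop K L)) (Z : set (bop H K)) S T :
  X S -> Z T -> cspan (bprod X Z) (S \bo T).
Proof. by move=> XS ZT; apply: sub_cspan; exists S => //; exists T. Qed.

Lemma cspan_bprod_min (X : set (bop K L)) (Z : set (bop H K)) C :
  closed_subspace C -> (forall S T, X S -> Z T -> C (S \bo T)) ->
  cspan (bprod X Z) `<=` C.
Proof. by move=> Cc h; apply: cspan_min => // _ [S XS [T ZT <-]]; exact: h. Qed.

Lemma closed_subspace_lunit (T : Type) (F : set_system T) {FF : Filter F}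
    (e : T -> bop K K) : (forall t, rnorm (e t) <= 1) ->
  closed_subspace [set x : bop H K | e t \bo x @[t --> F] --> x].
Proof.
move=> e1; apply: (closed_subspace_approx_unit (Phi := fun t x => e t \bo x)).
  by move=> t c x y; rewrite bcompDr bcompZr.
by move=> t x; exact: rnorm_bcomp_le1l.
Qed.

Lemma closed_subspace_runit (T : Type) (F : set_system T) {FF : Filter F}
    (e : T -> bop H H) : (forall t, rnorm (e t) <= 1) ->
  closed_subspace [set x : bop H K | x \bo e t @[t --> F] --> x].
Proof.
move=> e1; apply: (closed_subspace_approx_unit (Phi := fun t x => x \bo e t)).
  by move=> t c x y; rewrite bcompDl bcompZl.
by move=> t x; exact: rnorm_bcomp_le1r.
Qed.

Lemma cvg_compl (T : Type) (F : set_system T) {FF : Filter F} (S : bop K L)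
    (f : T -> bop H K) x : f @ F --> x -> S \bo f t @[t --> F] --> S \bo x.
Proof.
move=> /cvg_rnormP fx; apply/cvg_rnormP => e e0.
have k0 : 0 < 1 + rnorm S by rewrite ltr_pwDl ?rnorm_ge0.
near=> t; rewrite -bcompBr (le_lt_trans (rnorm_bcomp _ _))//.
have : rnorm (f t - x) < e / (1 + rnorm S).
  by near: t; apply: fx; rewrite divr_gt0.
rewrite ltr_pdivlMr//; apply: le_lt_trans; rewrite mulrC ler_wpM2l ?rnorm_ge0//.
by rewrite lerDr.
Unshelve. all: by end_near. Qed.

Lemma cvg_compr (T : Type) (F : set_system T) {FF : Filter F} (S : bop H K)
    (f : T -> bop K L) x : f @ F --> x -> f t \bo S @[t --> F] --> x \bo S.
Proof.
move=> /cvg_rnormP fx; apply/cvg_rnormP => e e0.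
have k0 : 0 < 1 + rnorm S by rewrite ltr_pwDl ?rnorm_ge0.
near=> t; rewrite -bcompBl (le_lt_trans (rnorm_bcomp _ _))//.
have : rnorm (f t - x) < e / (1 + rnorm S).
  by near: t; apply: fx; rewrite divr_gt0.
rewrite ltr_pdivlMr//; apply: le_lt_trans; rewrite ler_wpM2l ?rnorm_ge0//.
by rewrite lerDr.
Unshelve. all: by end_near. Qed.

Lemma cvg_adj (T : Type) (F : set_system T) {FF : Filter F}
    (f : T -> bop H K) x : f @ F --> x -> adj (f t) @[t --> F] --> adj x.
Proof.
move=> /cvg_rnormP fx; apply/cvg_rnormP => e e0.
by near=> t; rewrite -adjB rnorm_adj; near: t; exact: fx.
Unshelve. all: by end_near. Qed.

End Operators.

Section IteratedFilter.
Variables (T : Type) (F : set_system T).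

(** Encodes the limit in t followed by the limit in n as a single filter, as [has_cai] requires. The
    threshold in t may depend on n, so the filter is finer than the product filter; no uniformity of
    the inner limits is available. *)
Definition iter_filter : set_system (nat * T) :=
  [set S | \forall n \near \oo, \forall t \near F, S (n, t)].

Global Instance iter_filter_proper {FF : ProperFilter F} : ProperFilter iter_filter.
Proof.
apply: Build_ProperFilter_ex => [S h|].
  have [n hn] := @filter_ex _ \oo _ _ h; have [t ht] := filter_ex hn.
  by exists (n, t).
split=> [|P Q|P Q PQ]; rewrite /iter_filter /=.
- by apply: filterE => n; exact: filterT.
- by move=> hP hQ; apply: filterS2 hP hQ => n; exact: filterI.
- by apply: filterS => n; apply: filterS => t; exact: PQ.
Qed.

Lemma cvg_iter_filter {FF : ProperFilter F} (V : normedModType R[i])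
    (f : nat -> T -> V) (g : nat -> V) (x : V) :
  (forall n, f n t @[t --> F] --> g n) -> g n @[n --> \oo] --> x ->
  f nt.1 nt.2 @[nt --> iter_filter] --> x.
Proof.
move=> fg /cvg_rnormP gx; apply/cvg_rnormP => e e0.
have e2 : 0 < e / 2 by rewrite divr_gt0.
rewrite /prop_near1 /nbhs/= /iter_filter/=.
near=> n; have gn : rnorm (g n - x) < e / 2 by near: n; exact: gx.
have fn : \forall t \near F, rnorm (f n t - g n) < e / 2.
  exact: cvg_rnormP.1 (fg n) _ e2.
near=> t; rewrite (le_lt_trans (rnorm_trans (g n) _ _))// [ltRHS]splitr ltrD//.
by near: t.
Unshelve. all: by end_near. Qed.

End IteratedFilter.

End ClosedSubspaces.

(** * Sigma-TROs and rigged subspaces *)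

Section SigmaTROs.
Context {R : realType}.

Lemma cvg_sum_ord (V : normedModType R[i]) (T : Type) (F : set_system T)
    {FF : Filter F} n (f : 'I_n -> T -> V) (l : 'I_n -> V) :
  (forall i, f i t @[t --> F] --> l i) ->
  (\sum_i f i t) @[t --> F] --> \sum_i l i.
Proof.
elim: n f l => [|n IH] f l fl.
  rewrite big_ord0 (_ : (fun t => _) = cst 0); first exact: cvg_cst.
  by apply/funext => t; rewrite big_ord0.
rewrite big_ord_recr (_ : (fun t => _) =
  (fun t => (\sum_(i < n) f (widen_ord (leqnSn n) i) t) + f ord_max t)); last first.
  by apply/funext => t; rewrite big_ord_recr.
by apply: cvgD => //; exact: IH.
Qed.

Lemma is_TRO_adj (H K : hilbertType R) (M : set (bop H K)) :
  is_TRO M -> is_TRO (@adj R H K @` M).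
Proof.
move=> [[M0 Ml] M3]; split; first split.
- by exists 0 => //; rewrite adj0.
- move=> c _ _ [x Mx <-] [y My <-]; exists (Num.conj c *: x + y); first exact: Ml.
  by rewrite adjD adjZ conjCK.
- move=> _ _ _ [x Mx <-] [y My <-] [z Mz <-].
  by exists (z \bo adj y \bo x); [exact: M3 | rewrite !adj_comp bcompA].
Qed.

Lemma is_sigmaTRO_adj (H K : hilbertType R) (M : set (bop H K)) :
  is_sigmaTRO M -> is_sigmaTRO (@adj R H K @` M).
Proof.
move=> [MT Mc [p [q [pqM pm mq P1 Q1]]]].
split; first exact: is_TRO_adj.
- suff -> : @adj R H K @` M = [set T | M (adj T)].
    have Ms : closed_subspace M by split; [exact: MT.1|].
    by have [] := closed_subspace_adj Ms.
  apply/seteqP; split=> [_ [x Mx <-]|x Mx]; first by rewrite /= adjK.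
  by exists (adj x); rewrite ?adjK.
- exists (fun i => adj (q i)), (fun i => adj (p i)); split.
  + by move=> i; have [] := pqM i; split; [exists (q i) | exists (p i)].
  + move=> _ [m Mm <-]; rewrite (_ : (fun n => _) =
      (fun n => adj (\sum_(i < n) (m \bo adj (q i) \bo q i)))).
      by apply: cvg_adj; exact: mq.
    apply/funext => n; rewrite adj_sum; apply: eq_bigr => i _.
    by rewrite !adj_comp bcompA.
  + move=> _ [m Mm <-]; rewrite (_ : (fun n => _) =
      (fun n => adj (\sum_(i < n) (p i \bo adj (p i) \bo m)))).
      by apply: cvg_adj; exact: pm.
    apply/funext => n; rewrite adj_sum; apply: eq_bigr => i _.
    by rewrite !adj_comp bcompA.
  + by move=> n; under eq_bigr do rewrite adjK; exact: Q1.
  + by move=> n; under eq_bigr do rewrite adjK; exact: P1.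
Qed.

(** For a fixed nonzero v, an operator x is scalar exactly when <v,v> x u = <x v,v> u for all u, and
    each of these conditions is closed. If H = 0, every operator is scalar. *)
Lemma closed_scalar_operators (H : hilbertType R) :
  closed [set c *: bid H | c in [set: R[i]]].
Proof.
have [[v v0]|H0] := pselect (exists v : H, v != 0); last first.
  suff -> : [set c *: bid H | c in [set: R[i]]] = setT by exact: closedT.
  apply/seteqP; split=> // x _; exists 0 => //; apply: bop_ext => u.
  suff z w : w = 0 :> H by rewrite [LHS]z [RHS]z.
  by apply: contrapT => /eqP w0; apply: H0; exists w.
have vv0 : hdot v v != 0.
  by rewrite hdotE sqrf_eq0 normr_eq0.
pose D u : set (bop H H) := [set x | hdot v v *: x u - hdot (x v) v *: u = 0].
have -> : [set c *: bid H | c in [set: R[i]]] = \bigcap_(u in setT) D u.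
  apply/seteqP; split=> [_ [c _ <-] u _|x xD].
    by rewrite /D /= linearZl_LR /= scalerA mulrC subrr.
  exists (hdot (x v) v / hdot v v) => //; apply: bop_ext => u.
  have /eqP := xD u I; rewrite subr_eq0 => /eqP h.
  by rewrite [LHS]/= mulrC -[LHS]scalerA -h scalerA mulVf// scale1r.
apply: closed_bigI => u _.
have /= C0 : closed_subspace [set 0 : H].
  split; last first.
    apply: closed_rnormW => x h; apply: rnorm_lt_eps => r r0.
    by have [_ -> ] := h r r0; rewrite subr0 => /ltW.
  by split=> // c _ _ -> ->; rewrite scaler0 addr0.
apply: (@closed_subspace_preimage _ _ _ id
  (fun x : bop H H => hdot v v *: x u - hdot (x v) v *: u) _
  (complex.Re `|hdot v v| * rnorm u + rnorm v * rnorm v * rnorm u) _ _ C0).2.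
  move=> c x y; rewrite /= linearDl linearZl_LR /=.
  rewrite !scalerDr !scalerDl !scalerA (mulrC c) -!addrA; congr (_ + _).
    by rewrite mulrC.
  by rewrite opprD scalerN !scalerA (mulrC c) addrCA.
move=> x /=; rewrite (le_trans (rnormD _ _))// mulrDl lerD//.
  rewrite rnormZ -mulrA ler_wpM2l//; first by rewrite -ler0c RRe_real.
  by rewrite mulrC rnorm_app.
rewrite rnormN rnormZ mulrAC ler_wpM2r ?rnorm_ge0//.
rewrite (le_trans (norm_hdot_le _ _))// mulrAC ler_wpM2r ?rnorm_ge0//.
by rewrite mulrC rnorm_app.
Qed.

Lemma is_sigmaTRO_scalar (H : hilbertType R) :
  is_sigmaTRO [set c *: bid H | c in [set: R[i]]].
Proof.
pose u (i : nat) : bop H H := if i == 0%N then bid H else 0.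
have uu i : u i \bo adj (u i) = u i.
  by rewrite /u; case: eqP => _; rewrite ?adj_bid ?bid_comp ?bcomp0l.
have uu' i : adj (u i) \bo u i = u i.
  by rewrite /u; case: eqP => _; rewrite ?adj_bid ?bid_comp ?bcomp0r.
have us n : \sum_(i < n.+1) u i = bid H.
  by rewrite big_ord_recl /= big1 ?addr0// => i _.
have us1 n : `|\sum_(i < n) u i| <= 1.
  rewrite -rnorm_le1; case: n => [|n]; first by rewrite big_ord0 rnorm0.
  by rewrite us; apply: rnorm_bop_le => // x; rewrite mul1r.
split.
- split; first split.
  + by exists 0 => //; rewrite scale0r.
  + by move=> c _ _ [x _ <-] [y _ <-]; exists (c * x + y) => //; rewrite scalerDl scalerA.
  + move=> _ _ _ [x _ <-] [y _ <-] [z _ <-]; exists (x * Num.conj y * z) => //.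
    rewrite adjZ adj_bid !(bcompZl, bcompZr) !bid_comp !scalerA.
    by congr (_ *: _); ring.
- exact: closed_scalar_operators.
- exists u, u; split.
  + by move=> i; split; exists (i == 0%N)%:R => //; rewrite /u; case: eqP; rewrite ?scale1r ?scale0r.
  (* The partial sum at n = 0 is empty, hence 0; from n = 1 on it is the identity. *)
  + move=> m _; rewrite -cvg_shiftS /=.
    rewrite (_ : (fun n => _) = cst m); first exact: cvg_cst.
    apply/funext => n; rewrite -bcomp_suml; under eq_bigr do rewrite uu.
    by rewrite us bid_comp.
  + move=> m _; rewrite -cvg_shiftS /=.
    rewrite (_ : (fun n => _) = cst m); first exact: cvg_cst.
    apply/funext => n; under eq_bigr do rewrite -bcompA uu'.
    by rewrite -bcomp_sumr us comp_bid.
  + by move=> n; under eq_bigr do rewrite uu; exact: us1.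
  + by move=> n; under eq_bigr do rewrite uu'; exact: us1.
Qed.

(** The operator is row times diag(T) times adjoint row, where the row of the p_i is a contraction.
    Pairing z with itself and using the arithmetic-geometric mean inequality termwise gives |z|^2 <=
    (|x|^2 + |z|^2)/2, without forming the Hilbert sum. *)
Lemma rnorm_compression (H K : hilbertType R) n (p : 'I_n -> bop H K) (T : bop H H) :
  rnorm (\sum_i (p i \bo adj (p i))) <= 1 -> rnorm T <= 1 ->
  rnorm (\sum_i (p i \bo T \bo adj (p i))) <= 1.
Proof.
move=> P1 T1; apply: rnorm_bop_le => // x; rewrite mul1r.
have pS y : \sum_i rnorm (adj (p i) y) ^+ 2 <= rnorm y ^+ 2.
  have -> : \sum_i rnorm (adj (p i) y) ^+ 2 = rdot ((\sum_i (p i \bo adj (p i))) y) y.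
    rewrite bop_sumE rdot_suml; apply: eq_bigr => i _.
    by rewrite -rdotE; apply/esym/(radjE (p i)).
  rewrite (le_trans (rdot_le _ _))// expr2 ler_wpM2r ?rnorm_ge0//.
  by have := rnorm_app_le y P1; rewrite mul1r.
set z := bop_fun _ x.
have : rdot z z <= (rnorm x ^+ 2 + rnorm z ^+ 2) / 2.
  rewrite {1}/z bop_sumE rdot_suml.
  apply: (@le_trans _ _ (\sum_i (rnorm (adj (p i) x) ^+ 2 + rnorm (adj (p i) z) ^+ 2) / 2)).
    apply: ler_sum => i _; rewrite [leLHS](radjE (p i)) (le_trans (rdot_le _ _))//.
    have := rnorm_app_le (adj (p i) x) T1; rewrite mul1r.
    have := rnorm_ge0 (adj (p i) z); have := sqr_ge0 (rnorm (adj (p i) x) - rnorm (adj (p i) z)).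
    rewrite /=; nra.
  rewrite -mulr_suml ler_wpM2r// big_split /= lerD//.
rewrite rdotE => h; rewrite -ler_sqr ?nnegrE ?rnorm_ge0//; lra.
Qed.

End SigmaTROs.

(** * The algebras A0 and B of a rigged subspace, and their equivalences *)

Section Rigging.
Context {R : realType}.
Variables (H K : hilbertType R) (RA : set (bop H H)) (M : set (bop H K)).
Hypothesis RAs : closed_subspace RA.
Hypothesis RAm : forall x y, RA x -> RA y -> RA (x \bo y).
Hypothesis Msig : is_sigmaTRO M.
Hypothesis MMA : forall m n x, M m -> M n -> RA x -> RA (adj m \bo n \bo x).
Variables (T : Type) (F : set_system T) (e : T -> bop H H).
Hypothesis FF : ProperFilter F.
Hypothesis eRA : forall t, RA (e t).
Hypothesis e1 : forall t, rnorm (e t) <= 1.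
Hypothesis el : forall x, RA x -> e t \bo x @[t --> F] --> x.
Hypothesis er : forall x, RA x -> x \bo e t @[t --> F] --> x.
Variables p q : nat -> bop H K.
Hypothesis pM : forall i, M (p i).
Hypothesis qM : forall i, M (q i).
Hypothesis pm : forall m, M m -> \sum_(i < n) (p i \bo adj (p i) \bo m) @[n --> \oo] --> m.
Hypothesis mq : forall m, M m -> \sum_(i < n) (m \bo adj (q i) \bo q i) @[n --> \oo] --> m.
Hypothesis P1 : forall n : nat, rnorm (\sum_(i < n) (p i \bo adj (p i))) <= 1.
Hypothesis Q1 : forall n : nat, rnorm (\sum_(i < n) (adj (q i) \bo q i)) <= 1.

Let M3 : forall x y z, M x -> M y -> M z -> M (x \bo adj y \bo z).
Proof. by case: Msig => [[]]. Qed.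

Let P (n : nat) := \sum_(i < n) (p i \bo adj (p i)).
Let Q (n : nat) := \sum_(i < n) (adj (q i) \bo q i).

Let Pm m : M m -> P n \bo m @[n --> \oo] --> m.
Proof.
move=> /pm; rewrite (_ : (fun n => _) = (fun n => P n \bo m))//.
by apply/funext => n; rewrite /P bcomp_suml.
Qed.

Let mQ m : M m -> m \bo Q n @[n --> \oo] --> m.
Proof.
move=> /mq; rewrite (_ : (fun n => _) = (fun n => m \bo Q n))//.
by apply/funext => n; rewrite /Q bcomp_sumr; apply: eq_bigr => i _; rewrite bcompA.
Qed.

Let adjP n : adj (P n) = P n.
Proof. by rewrite adj_sum; apply: eq_bigr => i _; rewrite adj_comp adjK. Qed.

Let adjQ n : adj (Q n) = Q n.
Proof. by rewrite adj_sum; apply: eq_bigr => i _; rewrite adj_comp adjK. Qed.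

Let Qm m : M m -> Q n \bo adj m @[n --> \oo] --> adj m.
Proof.
move=> /mQ /cvg_adj; rewrite (_ : (fun n => _) = (fun n => Q n \bo adj m))//.
by apply/funext => n; rewrite adj_comp adjQ.
Qed.

Let mP m : M m -> adj m \bo P n @[n --> \oo] --> adj m.
Proof.
move=> /Pm /cvg_adj; rewrite (_ : (fun n => _) = (fun n => adj m \bo P n))//.
by apply/funext => n; rewrite adj_comp adjP.
Qed.

Local Notation W := (cspan (bprod M RA)).

Lemma mem_W m x : M m -> RA x -> W (m \bo x).
Proof. exact: mem_cspan_bprod. Qed.

Lemma W_min (C : set (bop H K)) : closed_subspace C ->
  (forall m x, M m -> RA x -> C (m \bo x)) -> W `<=` C.
Proof. exact: cspan_bprod_min. Qed.

Lemma adjM_W m w : M m -> W w -> RA (adj m \bo w).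
Proof.
move=> Mm; move: w; apply: W_min => [|n y Mn RAy]; first exact: closed_subspace_compl.
by rewrite /= bcompA; exact: MMA.
Qed.

Definition compression (nt : nat * T) : bop K K :=
  \sum_(i < nt.1) (p i \bo e nt.2 \bo adj (p i)).

Lemma compression_le1 nt : rnorm (compression nt) <= 1.
Proof. exact: rnorm_compression. Qed.

(** For fixed n each p_i^* w lies in RA, so the limit in t replaces e by the identity and leaves
    [P n \bo w]; this tends to w because [P n] is a left approximate unit for M. *)
Lemma compression_W w : W w -> compression nt \bo w @[nt --> iter_filter F] --> w.
Proof.
move=> Ww; apply: (@cvg_iter_filter _ _ _ _ _
    (fun n t => compression (n, t) \bo w) (fun n => P n \bo w)).
  move=> n; rewrite /P bcomp_suml.
  rewrite (_ : (fun t => _) = (fun t =>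
    \sum_(i < n) (p i \bo (e t \bo (adj (p i) \bo w))))); last first.
    by apply/funext => t; rewrite bcomp_suml; apply: eq_bigr => i _; rewrite !bcompA.
  apply: cvg_sum_ord => i; rewrite -bcompA; apply: cvg_compl; apply: el.
  exact: adjM_W.
move: w Ww; apply: W_min => [|m x Mm RAx]; first exact: closed_subspace_lunit.
rewrite /= (_ : (fun n => _) = (fun n => (P n \bo m) \bo x)).
  by apply: cvg_compr; exact: Pm.
by apply/funext => n; rewrite bcompA.
Qed.

Local Notation A0 := (cspan (bprod (bprod (@adj R H K @` M) M) RA)).
Local Notation B := (cspan (bprod (bprod M RA) (@adj R H K @` M))).

Hypothesis double : A0 = cspan (bprod RA (bprod (@adj R H K @` M) M)).

Lemma mem_A0 m n x : M m -> M n -> RA x -> A0 (adj m \bo n \bo x).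
Proof.
by move=> Mm Mn; apply: mem_cspan_bprod; exists (adj m); [exists m | exists n].
Qed.

Lemma mem_A0r m n x : M m -> M n -> RA x -> A0 (x \bo (adj m \bo n)).
Proof.
move=> Mm Mn RAx; rewrite double; apply: mem_cspan_bprod => //.
by exists (adj m); [exists m | exists n].
Qed.

Lemma A0_min (C : set (bop H H)) : closed_subspace C ->
  (forall m n x, M m -> M n -> RA x -> C (adj m \bo n \bo x)) -> A0 `<=` C.
Proof.
move=> Cs h; apply: cspan_bprod_min => // _ x [_ [m Mm <-] [n Mn <-]].
exact: h.
Qed.

(** [double] provides this second induction principle, with the RA factor on the left of the
    generators; it serves products with RA from the left and with [Q n] from the right. *)
Lemma A0_minr (C : set (bop H H)) : closed_subspace C ->
  (forall m n x, M m -> M n -> RA x -> C (x \bo (adj m \bo n))) -> A0 `<=` C.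
Proof.
move=> Cs h; rewrite double; apply: cspan_bprod_min => // x _ RAx [_ [m Mm <-] [n Mn <-]].
exact: h.
Qed.

Lemma A0_sub_RA : A0 `<=` RA.
Proof. exact: A0_min. Qed.

Lemma RA_A0 x y : RA x -> A0 y -> A0 (x \bo y).
Proof.
move=> RAx; move: y; apply: A0_minr => [|m n z Mm Mn RAz].
  exact/closed_subspace_compl/cspan_closed_subspace.
by rewrite /= bcompA; apply: mem_A0r => //; exact: RAm.
Qed.

(** The mirror image of [MMA], which allows M^* M only on the left of RA. It comes from [double],
    and it lets B map M into W and have a right approximate unit. *)
Lemma RA_adjM_M m n x : M m -> M n -> RA x -> RA (x \bo (adj m \bo n)).
Proof. by move=> Mm Mn RAx; apply/A0_sub_RA/mem_A0r. Qed.

Lemma A0_lunit y : A0 y -> Q n \bo y @[n --> \oo] --> y.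
Proof.
move: y; apply: A0_min => [|m n x Mm Mn RAx]; first exact: closed_subspace_lunit.
rewrite /= -bcompA (_ : (fun k => _) = (fun k => Q k \bo adj m \bo (n \bo x))).
  by apply: cvg_compr; exact: Qm.
by apply/funext => k; rewrite bcompA.
Qed.

Lemma A0_runit y : A0 y -> y \bo Q n @[n --> \oo] --> y.
Proof.
move: y; apply: A0_minr => [|m n x Mm Mn RAx]; first exact: closed_subspace_runit.
rewrite /= (_ : (fun k => _) = (fun k => (x \bo adj m) \bo (n \bo Q k))).
  by rewrite bcompA; apply: cvg_compl; exact: mQ.
by apply/funext => k; rewrite !bcompA.
Qed.

(** Keeps y Q_n inside A0, hence inside RA, where e acts as a right approximate unit; [A0_has_cai]
    needs this for its inner limit. *)
Lemma A0_Q n y : A0 y -> A0 (y \bo Q n).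
Proof.
have A0s := @cspan_closed_subspace R _ (bprod (bprod (@adj R H K @` M) M) RA).
move=> A0y; rewrite bcomp_sumr; apply: subspace_sum A0s.1 _ => i.
by apply: mem_A0r => //; exact: A0_sub_RA.
Qed.

Lemma A0_operator_algebra : concrete_operator_algebra A0.
Proof.
have [? ?] := @cspan_closed_subspace R _ (bprod (bprod (@adj R H K @` M) M) RA).
by split=> // x y /A0_sub_RA A0x A0y; exact: RA_A0.
Qed.

Lemma A0_has_cai : has_cai (@bcomp R H H H) A0.
Proof.
exists (nat * T)%type, (iter_filter F), (fun nt => Q nt.1 \bo e nt.2); split.
- exact: iter_filter_proper.
- move=> [n t]; split; last first.
    by rewrite -rnorm_le1; apply: le_trans (e1 t); exact/rnorm_bcomp_le1l/Q1.
  have [A0l _] := @cspan_closed_subspace R _ (bprod (bprod (@adj R H K @` M) M) RA).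
  by rewrite bcomp_suml; apply: subspace_sum A0l _ => i; exact: mem_A0.
- move=> x A0x; apply: (@cvg_iter_filter _ _ _ _ _
    (fun n t => Q n \bo e t \bo x) (fun n => Q n \bo x)); last exact: A0_lunit.
  move=> n; rewrite (_ : (fun t => _) = (fun t => Q n \bo (e t \bo x))).
    by apply: cvg_compl; apply/el/A0_sub_RA.
  by apply/funext => t; rewrite bcompA.
- move=> x A0x; apply: (@cvg_iter_filter _ _ _ _ _
    (fun n t => x \bo (Q n \bo e t)) (fun n => x \bo Q n)); last exact: A0_runit.
  move=> n; rewrite (_ : (fun t => _) = (fun t => (x \bo Q n) \bo e t)).
    by apply/er/A0_sub_RA/A0_Q.
  by apply/funext => t; rewrite bcompA.
Qed.

Lemma mem_B m x n : M m -> RA x -> M n -> B (m \bo x \bo adj n).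
Proof.
by move=> Mm RAx Mn; apply: mem_cspan_bprod; [exists m => //; exists x | exists n].
Qed.

Lemma B_min (C : set (bop K K)) : closed_subspace C ->
  (forall m x n, M m -> RA x -> M n -> C (m \bo x \bo adj n)) -> B `<=` C.
Proof.
move=> Cs h; apply: cspan_bprod_min => // _ _ [m Mm [x RAx <-]] [n Mn <-].
exact: h.
Qed.

Lemma W_adjM w n : W w -> M n -> B (w \bo adj n).
Proof.
move=> + Mn; move: w; apply: W_min => [|m x Mm RAx]; last exact: mem_B.
exact/closed_subspace_compr/cspan_closed_subspace.
Qed.

Lemma B_W b w : B b -> W w -> W (b \bo w).
Proof.
move=> + Ww; move: b; apply: B_min => [|m x n Mm RAx Mn].
  exact/closed_subspace_compr/cspan_closed_subspace.
rewrite /= -!bcompA; apply: mem_W => //; apply: RAm => //; exact: adjM_W.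
Qed.

Lemma B_M b n : B b -> M n -> W (b \bo n).
Proof.
move=> + Mn; move: b; apply: B_min => [|m x k Mm RAx Mk].
  exact/closed_subspace_compr/cspan_closed_subspace.
by rewrite /= -!bcompA; apply: mem_W => //; exact: RA_adjM_M.
Qed.

Lemma B_operator_algebra : concrete_operator_algebra B.
Proof.
have Bs := @cspan_closed_subspace R _ (bprod (bprod M RA) (@adj R H K @` M)).
split; [exact: Bs.1 | exact: Bs.2 | move=> b + Bb].
apply: B_min => [|m x n Mm RAx Mn]; first exact: closed_subspace_compl.
by rewrite /= bcompA; apply: W_adjM => //; apply: B_W => //; exact: mem_W.
Qed.

Lemma compression_B nt : B (compression nt).
Proof.
have Bs := @cspan_closed_subspace R _ (bprod (bprod M RA) (@adj R H K @` M)).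
by apply: subspace_sum Bs.1 _ => i; exact: mem_B.
Qed.

Lemma B_compression b : B b -> b \bo compression nt @[nt --> iter_filter F] --> b.
Proof.
move: b; apply: B_min => [|m x n Mm RAx Mn].
  by apply: closed_subspace_runit => nt; exact: compression_le1.
rewrite /=; apply: (@cvg_iter_filter _ _ _ _ _
  (fun k t => m \bo x \bo adj n \bo compression (k, t))
  (fun k => m \bo x \bo adj n \bo P k)).
  move=> k; rewrite /P bcomp_sumr.
  rewrite (_ : (fun t => _) = (fun t => \sum_(i < k)
    (m \bo ((x \bo (adj n \bo p i)) \bo e t) \bo adj (p i)))); last first.
    by apply/funext => t; rewrite bcomp_sumr; apply: eq_bigr => i _; rewrite !bcompA.
  apply: cvg_sum_ord => i.
  have -> : m \bo x \bo adj n \bo (p i \bo adj (p i)) =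
    m \bo (x \bo (adj n \bo p i)) \bo adj (p i) by rewrite !bcompA.
  by apply: cvg_compr; apply: cvg_compl; apply: er; exact: RA_adjM_M.
rewrite (_ : (fun k => _) = (fun k => (m \bo x) \bo (adj n \bo P k))).
  by apply: cvg_compl; exact: mP.
by apply/funext => k; rewrite !bcompA.
Qed.

Lemma B_has_cai : has_cai (@bcomp R K K K) B.
Proof.
exists (nat * T)%type, (iter_filter F), compression; split.
- exact: iter_filter_proper.
- by move=> nt; rewrite -rnorm_le1 compression_le1; split=> //; exact: compression_B.
- apply: B_min => [|m x n Mm RAx Mn].
    by apply: closed_subspace_lunit => nt; exact: compression_le1.
  rewrite /= (_ : (fun nt => _) = (fun nt => compression nt \bo (m \bo x) \bo adj n)).
    by apply: cvg_compr; apply: compression_W; exact: mem_W.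
  by apply/funext => nt; rewrite !bcompA.
- exact: B_compression.
Qed.

Lemma A0_equiv_B : sigmaTRO_equiv A0 B.
Proof.
exists M, M; split => //; apply/seteqP; split.
- move=> x A0x.
  set C := cspan _; have Cs : closed_subspace C by exact: cspan_closed_subspace.
  (* Q_n x Q_k is the sum of q_i^* b q_j with b = q_i x q_j^* in B. Letting n and then k tend to
     infinity recovers x. *)
  have CQ n k : C (Q n \bo (x \bo Q k)).
    rewrite /Q bcomp_suml; apply: subspace_sum Cs.1 _ => i.
    rewrite !bcomp_sumr; apply: subspace_sum Cs.1 _ => j.
    have -> : adj (q i) \bo q i \bo (x \bo (adj (q j) \bo q j)) =
      adj (q i) \bo (q i \bo x \bo adj (q j)) \bo q j by rewrite !bcompA.
    apply: mem_cspan_bprod => //; exists (adj (q i)); first by exists (q i).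
    exists (q i \bo x \bo adj (q j)) => //; apply: mem_B => //; exact: A0_sub_RA.
  apply: (closed_subspace_cvg Cs _ (A0_runit A0x)) => k.
  have A0xQ : A0 (x \bo Q k) by exact: A0_Q.
  by have := A0_lunit A0xQ; apply: closed_subspace_cvg.
- apply: cspan_bprod_min; first exact: cspan_closed_subspace.
  move=> _ n [_ [m Mm <-] [b Bb <-]] Mn; rewrite -bcompA.
  have Wbn := B_M Bb Mn.
  move: (b \bo n) Wbn; apply: W_min => [|k x Mk RAx].
    exact/closed_subspace_compl/cspan_closed_subspace.
  by rewrite /= bcompA; exact: mem_A0.
- apply: B_min; first exact: cspan_closed_subspace.
  move=> m x n Mm RAx Mn.
  set C := cspan _; have Cs : closed_subspace C by exact: cspan_closed_subspace.
  apply: (@closed_subspace_cvg _ _ C _ \oo _ (fun k => m \bo Q k \bo x \bo adj n)) => //.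
    move=> k; rewrite -(bcompA m) bcomp_suml bcomp_sumr bcomp_suml.
    apply: subspace_sum Cs.1 _ => i.
    apply: mem_cspan_bprod; last by exists n.
    exists m => //; exists (adj (q i) \bo q i \bo x) => //; exact: mem_A0.
  by do 2!apply: cvg_compr; exact: mQ.
- apply: cspan_bprod_min; first exact: cspan_closed_subspace.
  move=> _ _ [m Mm [x A0x <-]] [n Mn <-]; apply: mem_B => //; exact: A0_sub_RA.
Qed.

Lemma B_equiv_W : sigmaTRO_equiv B W.
Proof.
exists (@adj R H K @` M), [set c *: bid K | c in [set: R[i]]]; split.
- exact: is_sigmaTRO_adj.
- exact: is_sigmaTRO_scalar.
- apply/seteqP; split.
    apply: B_min; first exact: cspan_closed_subspace.
    move=> m x n Mm RAx Mn; apply: mem_cspan_bprod; last by exists n.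
    exists (adj (1 *: bid K)); first by exists (1 *: bid K) => //; exists 1.
    by exists (m \bo x); [exact: mem_W | rewrite scale1r adj_bid bid_comp].
  have Bs := @cspan_closed_subspace R _ (bprod (bprod M RA) (@adj R H K @` M)).
  apply: cspan_bprod_min => // _ _ [_ [_ [c _ <-] <-] [w Ww <-]] [n Mn <-].
  rewrite adjZ adj_bid !bcompZl bid_comp; apply: subspaceZ Bs.1 _.
  exact: W_adjM.
- have Ws := @cspan_closed_subspace R _ (bprod M RA).
  apply/seteqP; split.
    apply: W_min; first exact: cspan_closed_subspace.
    move=> m x Mm RAx; set C := cspan _.
    have Cs : closed_subspace C by exact: cspan_closed_subspace.
    apply: (@closed_subspace_cvg _ _ C _ \oo _ (fun k => m \bo Q k \bo x)) => //.
      move=> k; rewrite -(bcompA m) bcomp_suml bcomp_sumr.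
      apply: subspace_sum Cs.1 _ => i.
      (* The element q_i^* q_i x has its RA factor on the wrong side. By [double] it is approximated
         by sums of y k'^* l with y in RA; then m y k'^* lies in B and l in M. *)
      move: (mem_A0 (qM i) (qM i) RAx); move: (_ \bo x).
      apply: A0_minr => [|k' l y Mk Ml RAy]; first exact: closed_subspace_compl.
      rewrite /= !bcompA -[l]adjK; apply: mem_cspan_bprod.
        exists (1 *: bid K); first by exists 1.
        exists (m \bo y \bo adj k'); first exact: mem_B.
        by rewrite scale1r bid_comp.
      by exists (adj l) => //; exists l.
    by apply: cvg_compr; exact: mQ.
  apply: cspan_bprod_min => // _ _ [_ [c _ <-] [b Bb <-]] [_ [n Mn <-] <-].
  rewrite adjK bcompZl bid_comp bcompZl; apply: subspaceZ Ws.1 _.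
  exact: B_M.
Qed.

End Rigging.

Lemma rdot_iZ (R : realType) (H : hilbertType R) (x y : H) :
  rdot ('i%C *: x) ('i%C *: y) = rdot x y.
Proof.
rewrite /rdot linearZl_LR /= (hdotC x ('i%C *: y)) linearZl_LR /= rmorphM /= -hdotC.
by rewrite mulrA; case: (hdot x y) => p q /=; ring.
Qed.

(** * Isometric representations of C*-algebras *)

Section OperatorAlgebra.
Context {R : realType}.
Variable A : opalgType R.
Implicit Types (x y z : A) (c : R[i]).

(** [opmul] is specified only through a representation; bilinearity and submultiplicativity are
    pulled back along it. *)
Lemma opmul_isometric_rep : exists (H : hilbertType R) (j : {linear A -> bop H H}),
  (forall x, rnorm (j x) = rnorm x) /\ (forall x y, j (opmul x y) = j x \bo j y).
Proof.
have [H [j [jI jM]]] := @opmul_rep R A.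
by exists H, j; split=> // x; exact: completely_isometric_rnorm.
Qed.

Lemma isometric_inj (V W : normedModType R[i]) (f : {linear V -> W}) :
  (forall v, rnorm (f v) = rnorm v) -> injective f.
Proof.
move=> fI x y fxy; apply/eqP; rewrite -subr_eq0; apply/eqP/rnorm_eq0.
by rewrite -fI linearB fxy subrr rnorm0.
Qed.

Lemma opmulDl x y z : opmul (x + y) z = opmul x z + opmul y z.
Proof.
have [H [j [jI jM]]] := opmul_isometric_rep; apply: (isometric_inj jI).
by rewrite !(jM, linearD) bcompDl.
Qed.

Lemma opmulDr x y z : opmul x (y + z) = opmul x y + opmul x z.
Proof.
have [H [j [jI jM]]] := opmul_isometric_rep; apply: (isometric_inj jI).
by rewrite !(jM, linearD) bcompDr.
Qed.

Lemma opmulZl c x y : opmul (c *: x) y = c *: opmul x y.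
Proof.
have [H [j [jI jM]]] := opmul_isometric_rep; apply: (isometric_inj jI).
by rewrite jM !linearZ /= jM bcompZl.
Qed.

Lemma opmulZr c x y : opmul x (c *: y) = c *: opmul x y.
Proof.
have [H [j [jI jM]]] := opmul_isometric_rep; apply: (isometric_inj jI).
by rewrite jM !linearZ /= jM bcompZr.
Qed.

Lemma rnorm_opmul x y : rnorm (opmul x y) <= rnorm x * rnorm y.
Proof.
have [H [j [jI jM]]] := opmul_isometric_rep.
by rewrite -!jI jM rnorm_bcomp.
Qed.

Section CstarInvolution.
Variable star : A -> A.
Hypothesis starP : is_Cstar_involution star.

Lemma starD x y : star (x + y) = star x + star y.
Proof. by case: starP => h _ _ _; have := h 1 x y; rewrite rmorph1 !scale1r. Qed.

Lemma starZ c x : star (c *: x) = Num.conj c *: star x.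
Proof.
case: starP => h _ _ _; have s0 : star 0 = 0.
  by have /eqP := starD 0 0; rewrite addr0 -subr_eq0 opprD addrA subrr add0r oppr_eq0 => /eqP.
by have := h c x 0; rewrite !addr0 s0 addr0.
Qed.

Lemma starN x : star (- x) = - star x.
Proof. by rewrite -scaleN1r starZ rmorphN1 scaleN1r. Qed.

Lemma starK x : star (star x) = x. Proof. by case: starP. Qed.

Lemma starM x y : star (opmul x y) = opmul (star y) (star x).
Proof. by case: starP. Qed.

Lemma rnorm_star_mul x : rnorm (opmul (star x) x) = rnorm x ^+ 2.
Proof.
case: starP => _ _ _ h; have := h x; rewrite -!rnormE -rmorphXn.
by move/complexI.
Qed.

Lemma rnorm_star x : rnorm (star x) = rnorm x.
Proof.
suff le y : rnorm y <= rnorm (star y).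
  by apply/eqP; rewrite eq_le le andbT -{2}(starK x) le.
have := rnorm_opmul (star y) y; rewrite rnorm_star_mul.
have := rnorm_ge0 y; have := rnorm_ge0 (star y); nra.
Qed.

Section Representation.
Variables (H : hilbertType R) (a : {linear A -> bop H H}).
Hypothesis aI : forall x, rnorm (a x) = rnorm x.
Hypothesis aM : forall x y, a (opmul x y) = a x \bo a y.
Variables (I : Type) (F : set_system I) (e : I -> A).
Hypothesis FF : ProperFilter F.
Hypothesis e1 : forall t, rnorm (e t) <= 1.
Hypothesis el : forall x, opmul (e t) x @[t --> F] --> x.
Hypothesis er : forall x, opmul x (e t) @[t --> F] --> x.

Let E t := a (e t).

Let E1 t u : rnorm (E t u) <= rnorm u.
Proof. by rewrite -[leRHS]mul1r; apply: rnorm_app_le; rewrite /E aI. Qed.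

(** Substitute for |1 + i s h|^2 <= 1 + s^2 |h|^2 when A may lack a unit. By the C*-identity the
    square is the norm of the product with the adjoint, whose cross term is i s times e_t^* h - h
    e_t. It vanishes in the limit: e_t need not be selfadjoint, but e_t^* h -> h is the adjoint of h
    e_t -> h. *)
Lemma approx_unit_perturbation h (s d : R) : star h = h -> 0 < d ->
  \forall t \near F, rnorm (e t + (s%:C%C * 'i%C) *: h) ^+ 2 <= 1 + s ^+ 2 * rnorm h ^+ 2 + d.
Proof.
move=> hh d0.
have k0 : 0 < 1 + `|s| by rewrite ltr_pwDl.
have hn : \forall t \near F, rnorm (opmul h (e t) - h) < d / 2 / (1 + `|s|).
  by apply: (cvg_rnormP.1 (@er h)); rewrite !divr_gt0.
near=> t; have ht : rnorm (opmul h (e t) - h) < d / 2 / (1 + `|s|) by near: t.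
have ht' : rnorm (opmul (star (e t)) h - h) < d / 2 / (1 + `|s|).
  suff -> : opmul (star (e t)) h - h = star (opmul h (e t) - h) by rewrite rnorm_star.
  by rewrite starD starN starM hh.
rewrite -rnorm_star_mul starD starZ hh.
have -> : Num.conj (s%:C%C * 'i%C) = - (s%:C%C * 'i%C).
  by apply/eqP; rewrite eq_complex /=; apply/andP; split; apply/eqP; ring.
rewrite opmulDl !opmulDr opmulZl !opmulZr opmulZl scalerA.
have -> : s%:C%C * 'i%C * - (s%:C%C * 'i%C) = (s ^+ 2)%:C%C :> R[i].
  by apply/eqP; rewrite eq_complex /=; apply/andP; split; apply/eqP; ring.
set u := opmul _ _; set v := opmul _ h; set w := opmul h (e t); set z := opmul h h.
have -> : u + (s%:C%C * 'i%C) *: v + (- (s%:C%C * 'i%C) *: w + (s ^+ 2)%:C%C *: z) =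
    u + (s%:C%C * 'i%C) *: (v - w) + (s ^+ 2)%:C%C *: z.
  by rewrite addrA -addrA scalerBr scaleNr -!addrA.
have nu : rnorm u <= 1.
  by rewrite rnorm_star_mul expr_le1 ?rnorm_ge0.
have nz : rnorm z <= rnorm h ^+ 2 by rewrite expr2 rnorm_opmul.
have nvw : rnorm (v - w) < d / (1 + `|s|).
  rewrite (le_lt_trans (rnorm_trans h _ _))//.
  have -> : d / (1 + `|s|) = d / 2 / (1 + `|s|) + d / 2 / (1 + `|s|) by field; rewrite gt_eqF.
  by rewrite ltrD// rnormBC.
rewrite (le_trans (rnormD _ _))// (le_trans (lerD (rnormD _ _) (lexx _)))//.
rewrite !rnormZ.
have -> : complex.Re `|(s ^+ 2)%:C%C : R[i]| = s ^+ 2.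
  by rewrite ger0_norm// ler0c sqr_ge0.
have -> : complex.Re `|s%:C%C * 'i%C : R[i]| = `|s|.
  by rewrite normc_def /= -(sqrtr_sqr s); congr Num.sqrt; ring.
rewrite ltr_pdivlMr// in nvw.
have := rnorm_ge0 (v - w); have := normr_ge0 s; have := sqr_ge0 s.
by clear hh; nra.
Unshelve. all: by end_near. Qed.

(** Says that <h u, u> is real. Otherwise |u + i s h u|^2 would contain a term linear in s, against
    the bound 1 + O(s^2) of [approx_unit_perturbation]. *)
Lemma selfadjoint_rdot_real h u : star h = h ->
  E t u @[t --> F] --> u -> rdot ('i%C *: a h u) u = 0.
Proof.
move=> hh Eu; set T := a h; set b := rdot _ _.
have key (s : R) : rnorm (u + (s%:C%C * 'i%C) *: T u) ^+ 2 <=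
    (1 + s ^+ 2 * rnorm h ^+ 2) * rnorm u ^+ 2.
  apply/ler_addgt0Pr => d d0.
  pose k := 1 + rnorm u ^+ 2; have k0 : 0 < k by rewrite ltr_pwDl ?sqr_ge0.
  pose L := 1 + rnorm (u + (s%:C%C * 'i%C) *: T u) * 2.
  have L0 : 0 < L by rewrite ltr_pwDl ?mulr_ge0 ?rnorm_ge0.
  have h1 : \forall t \near F, rnorm (e t + (s%:C%C * 'i%C) *: h) ^+ 2 <=
      1 + s ^+ 2 * rnorm h ^+ 2 + d / 2 / k.
    by apply: approx_unit_perturbation => //; rewrite !divr_gt0.
  have h2 : \forall t \near F, rnorm (E t u - u) < d / 2 / L.
    by apply: (cvg_rnormP.1 Eu); rewrite !divr_gt0.
  have [t [{}h1 {}h2]] := filter_ex (filterI h1 h2).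
  have h3 : rnorm (E t u + (s%:C%C * 'i%C) *: T u) ^+ 2 <=
      (1 + s ^+ 2 * rnorm h ^+ 2 + d / 2 / k) * rnorm u ^+ 2.
    have -> : E t u + (s%:C%C * 'i%C) *: T u = a (e t + (s%:C%C * 'i%C) *: h) u.
      by rewrite linearD linearZ.
    apply: (@le_trans _ _ (rnorm (e t + (s%:C%C * 'i%C) *: h) ^+ 2 * rnorm u ^+ 2)).
      rewrite -exprMn ler_sqr ?nnegrE ?mulr_ge0 ?rnorm_ge0//.
      by apply: rnorm_app_le; rewrite aI.
    by rewrite ler_wpM2r ?sqr_ge0.
  have := rnorm_le_sub (u + (s%:C%C * 'i%C) *: T u) (E t u + (s%:C%C * 'i%C) *: T u).
  rewrite opprD addrACA subrr addr0 (rnormBC u).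
  have : d / 2 / k * rnorm u ^+ 2 <= d / 2.
    have d2 : 0 <= d / 2 by rewrite divr_ge0// ltW.
    by rewrite mulrAC ler_pdivrMr// ler_wpM2l// /k lerDr.
  rewrite ltr_pdivlMr// in h2.
  move: h2 h3; rewrite /L; move: (d / 2 / k) => dk.
  move: (rnorm_ge0 (E t u + (s%:C%C * 'i%C) *: T u)).
  move: (rnorm_ge0 (u + (s%:C%C * 'i%C) *: T u)) (rnorm_ge0 (E t u - u)).
  move: (rnorm (u + _)) (rnorm (E t u + _)) (rnorm (E t u - u)) (rnorm u ^+ 2) (rnorm h ^+ 2).
  clear -d0 => x y z u2 h2 x0 z0 y0 hz hy hd hxy.
  have : x ^+ 2 <= y ^+ 2 + 2 * x * z by case: (leP z x) => zx; nra.
  nra.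
have b0 (s : R) : 2 * s * b <= s ^+ 2 * (rnorm h ^+ 2 * rnorm u ^+ 2).
  have := key s; rewrite rnorm_sqrD -scalerA rdotZr (rdotC u) -/b.
  by have := sqr_ge0 (rnorm (s%:C%C *: ('i%C *: T u))); clear hh; nra.
set C := rnorm h ^+ 2 * _ in b0.
have C0 : 0 <= C by rewrite mulr_ge0 ?sqr_ge0.
(* With B = b^2 / (1 + C) this choice of s yields 2 B <= B C / (1 + C) <= B, so B = 0. *)
have := b0 (b / (1 + C)).
have -> : 2 * (b / (1 + C)) * b = 2 * (b ^+ 2 / (1 + C)) by ring.
have -> : (b / (1 + C)) ^+ 2 * C = b ^+ 2 / (1 + C) * (C / (1 + C)).
  by field; rewrite gt_eqF// ltr_pwDl.
have : C / (1 + C) <= 1 by rewrite ler_pdivrMr ?ltr_pwDl// mul1r lerDr.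
have : 0 <= b ^+ 2 / (1 + C) by rewrite divr_ge0 ?sqr_ge0 ?addr_ge0.
move: (C / _) => r; set B := b ^+ 2 / _ => B0 r1 h0.
have B1 : B = 0 by clear hh; apply/eqP; rewrite eq_le B0 andbT; nra.
apply/eqP; rewrite -sqrf_eq0; move/eqP: B1; rewrite mulf_eq0 invr_eq0.
by case/orP=> // /eqP C1; move: C0; rewrite -[C](addKr 1) C1; lra.
Qed.

(** Polarisation, followed by replacing u with i u; both stay inside the subspace of vectors on
    which E_t converges to the identity. *)
Lemma selfadjoint_on_nondegenerate h u v : star h = h ->
  E t u @[t --> F] --> u -> E t v @[t --> F] --> v -> rdot (a h u) v = rdot u (a h v).
Proof.
move=> hh.
have sub (x y : H) c : E t x @[t --> F] --> x -> E t y @[t --> F] --> y ->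
    E t (c *: x + y) @[t --> F] --> c *: x + y.
  move=> Ex Ey; rewrite (_ : (fun t => _) = (fun t => c *: E t x + E t y)).
    by apply: cvgD => //; apply: cvgZr.
  by apply/funext => t; rewrite linearP.
have pol (x y : H) : E t x @[t --> F] --> x -> E t y @[t --> F] --> y ->
    rdot ('i%C *: a h x) y + rdot ('i%C *: a h y) x = 0.
  move=> Ex Ey; have := selfadjoint_rdot_real hh (sub x y 1 Ex Ey).
  rewrite scale1r linearD scalerDr rdotDl !rdotDr.
  by rewrite !(selfadjoint_rdot_real hh)// addr0 add0r.
move=> Eu Ev.
have Eiu : E t ('i%C *: u) @[t --> F] --> 'i%C *: u.
  by have := sub u 0 'i%C Eu; rewrite addr0; apply; rewrite (_ : (fun t => _) = cst 0);
    [exact: cvg_cst | apply/funext => t; rewrite linear0].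
have := pol _ _ Eiu Ev.
have -> : 'i%C *: a h ('i%C *: u) = - a h u.
  by rewrite linearZ scalerA (_ : 'i%C * 'i%C = -1 :> R[i]) ?scaleN1r// -expr2 sqr_i.
rewrite rdotNl => /eqP; rewrite addrC subr_eq0 => /eqP <-.
by rewrite rdot_iZ rdotC.
Qed.

(** Nothing is known yet about the adjoint of E_t. Instead, contractivity at x + r y, with r = s or
    -s and s large, bounds 2 r times <E_t x, E_t y> - <x, y> by a constant, since |E_t y| tends to
    |y|. *)
Lemma approx_unit_weak (x y : H) : E t y @[t --> F] --> y ->
  rdot (E t x) y @[t --> F] --> rdot x y.
Proof.
move=> Ey; apply/cvgrPdist_lt => d d0.
pose X := rnorm x ^+ 2 + 1; have X0 : 0 < X by rewrite ltr_wpDl ?sqr_ge0.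
have [s s0 sd] : exists2 s : R, 0 < s & s * d = X.
  by exists (X / d); rewrite ?divr_gt0 ?divfK// gt_eqF.
(* The second summand of N makes the error <E_t x, z> at most d/4; the third makes s^2 times |y|^2 -
   |E_t y|^2 at most 1, the 1 in X. With s d = X the main term is at most d/2. *)
pose N := 1 + 4 * rnorm x / d + s ^+ 2 * 2 * rnorm y.
have N1 : 0 <= 4 * rnorm x / d.
  by rewrite !mulr_ge0 ?invr_ge0 ?rnorm_ge0 ?(ltW d0).
have N2 : 0 <= s ^+ 2 * 2 * rnorm y by rewrite mulr_ge0 ?rnorm_ge0// mulr_ge0// sqr_ge0.
have N0 : 0 < N by rewrite /N; lra.
near=> t.
have hE : rnorm (E t y - y) < N^-1.
  by near: t; apply: (cvg_rnormP.1 Ey); rewrite invr_gt0.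
set z := E t y - y in hE.
have zN : rnorm z * N < 1 by rewrite -ltr_pdivlMr// mul1r.
have Ex := E1 t x; have Ey1 := E1 t y.
have yy : rnorm y <= rnorm (E t y) + rnorm z by rewrite rnormBC rnorm_le_sub.
have z1 : rnorm z * rnorm x * 4 <= d.
  have : rnorm z * (4 * rnorm x / d) <= 1.
    apply: le_trans (ltW zN); rewrite ler_wpM2l ?rnorm_ge0// /N.
    lra.
  by rewrite !mulrA ler_pdivrMr// mul1r mulrAC.
have z2 : s ^+ 2 * (rnorm y ^+ 2 - rnorm (E t y) ^+ 2) <= 1.
  have : rnorm z * (s ^+ 2 * 2 * rnorm y) <= 1.
    apply: le_trans (ltW zN); rewrite ler_wpM2l ?rnorm_ge0// /N.
    lra.
  apply: le_trans.
  have -> : rnorm z * (s ^+ 2 * 2 * rnorm y) = s ^+ 2 * (rnorm z * 2 * rnorm y) by ring.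
  rewrite ler_wpM2l ?sqr_ge0//.
  by move: (rnorm_ge0 y) (rnorm_ge0 (E t y)) (rnorm_ge0 z); nra.
have zx : `|rdot (E t x) z| <= rnorm x * rnorm z.
  rewrite ler_norml lerNl -rdotNl -{2}(rnormN x) -{1}(rnormN x).
  rewrite rnormN; apply/andP; split.
    rewrite (le_trans (rdot_le _ _))// rnormN ler_wpM2r ?rnorm_ge0//.
  by rewrite (le_trans (rdot_le _ _))// ler_wpM2r ?rnorm_ge0.
have key (r : R) : r ^+ 2 = s ^+ 2 -> 2 * r * (rdot (E t x) (E t y) - rdot x y) <= X.
  move=> rs; have : rnorm (E t (x + r%:C%C *: y)) ^+ 2 <= rnorm (x + r%:C%C *: y) ^+ 2.
    by rewrite ler_sqr ?nnegrE ?rnorm_ge0.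
  rewrite linearD linearZ !rnorm_sqrD !rdotZr !rnormZ !exprMn.
  have -> : complex.Re `|r%:C%C : R[i]| ^+ 2 = s ^+ 2.
    by rewrite normc_def /= expr0n /= addr0 sqrtr_sqr real_normK ?num_real.
  by move: z2; rewrite /X; have := sqr_ge0 (rnorm (E t x)); lra.
have k1 := key s erefl; have k2 := key (- s) (sqrrN s).
have Exy : rdot (E t x) y = rdot (E t x) (E t y) - rdot (E t x) z.
  by rewrite -rdotBr /z opprB addrC subrK.
rewrite Exy ltr_norml; move: zx; rewrite ler_norml => /andP[zx1 zx2].
move: k1 k2 zx1 zx2 z1; set B := rdot (E t x) (E t y); set D := rdot _ z.
move: (rdot x y) => C k1 k2 zx1 zx2 z1.
have BC1 : B - C <= d / 2 by rewrite -(@ler_pM2l _ (2 * s)) ?mulr_gt0//; lra.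
have BC2 : C - B <= d / 2 by rewrite -(@ler_pM2l _ (2 * s)) ?mulr_gt0//; lra.
by apply/andP; split; lra.
Unshelve. all: by end_near. Qed.

Lemma cvg_rdotl (J : Type) (G : set_system J) {GF : Filter G} (f : J -> H) (x y : H) :
  f @ G --> x -> rdot (f t) y @[t --> G] --> rdot x y.
Proof.
move=> /cvg_rnormP fx; apply/cvgrPdist_lt => d d0.
have k0 : 0 < 1 + rnorm y by rewrite ltr_pwDl ?rnorm_ge0.
near=> t; have h : rnorm (f t - x) < d / (1 + rnorm y).
  by near: t; apply: fx; rewrite divr_gt0.
rewrite ltr_pdivlMr// in h; have h0 := rnorm_ge0 (f t - x).
have := rdot_le (f t - x) y; have := rdot_le (- (f t - x)) y.
rewrite rnormN rdotNl rdotBl ltr_norml => h1 h2.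
by apply/andP; split; lra.
Unshelve. all: by end_near. Qed.

(** Neither x nor y need be a limit of its images under E_t. Since h e_t -> h, replacing a vector
    under T by its image is harmless in norm; a bare vector is replaced weakly, its partner being in
    the range of a representing operator. This is done first for x, then for y. *)
Lemma star_representation_selfadjoint h : star h = h -> adj (a h) = a h.
Proof.
move=> hh; apply: adj_uniq => x y; set T := a h.
have ran b (z : H) : E t (a b z) @[t --> F] --> a b z.
  apply/cvg_rnormP => d d0; have k0 : 0 < 1 + rnorm z by rewrite ltr_pwDl ?rnorm_ge0.
  near=> t; have hb : rnorm (opmul (e t) b - b) < d / (1 + rnorm z).
    by near: t; apply: (cvg_rnormP.1 (@el b)); rewrite divr_gt0.
  rewrite ltr_pdivlMr// in hb.
  have -> : E t (a b z) - a b z = a (opmul (e t) b - b) z by rewrite linearB aM.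
  rewrite (le_lt_trans (rnorm_app _ _))// aI; apply: le_lt_trans hb.
  by rewrite ler_wpM2l ?rnorm_ge0// lerDr.
have TE (z : H) : T (E t z) @[t --> F] --> T z.
  apply/cvg_rnormP => d d0; have k0 : 0 < 1 + rnorm z by rewrite ltr_pwDl ?rnorm_ge0.
  near=> t; have hb : rnorm (opmul h (e t) - h) < d / (1 + rnorm z).
    by near: t; apply: (cvg_rnormP.1 (@er h)); rewrite divr_gt0.
  rewrite ltr_pdivlMr// in hb.
  have -> : T (E t z) - T z = a (opmul h (e t) - h) z by rewrite linearB aM.
  rewrite (le_lt_trans (rnorm_app _ _))// aI; apply: le_lt_trans hb.
  by rewrite ler_wpM2l ?rnorm_ge0// lerDr.
have step t : rdot (T x) (E t y) = rdot x (T (E t y)).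
  have l1 : rdot (T (E s x)) (E t y) @[s --> F] --> rdot (T x) (E t y).
    exact: cvg_rdotl (TE x).
  have l2 : rdot (E s x) (T (E t y)) @[s --> F] --> rdot x (T (E t y)).
    by apply: approx_unit_weak; exact: ran.
  apply: cvg_unique l1 _ => //.
  rewrite (_ : (fun s => _) = (fun s => rdot (E s x) (T (E t y))))//.
  by apply/funext => s; apply: selfadjoint_on_nondegenerate => //; exact: ran.
have l1 : rdot (E t y) (T x) @[t --> F] --> rdot y (T x).
  by apply: approx_unit_weak; exact: ran.
have l2 : rdot (T (E t y)) x @[t --> F] --> rdot (T y) x by exact: cvg_rdotl (TE y).
rewrite rdotC (rdotC x); apply: cvg_unique l1 _ => //.
by rewrite (_ : (fun t => _) = (fun t => rdot (T (E t y)) x))//;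
  apply/funext => t; rewrite rdotC step rdotC.
Unshelve. all: by end_near. Qed.

Theorem isometric_representation_star x : a (star x) = adj (a x).
Proof.
have h1 : star (x + star x) = x + star x by rewrite starD starK addrC.
have h2 : star ('i%C *: (x - star x)) = 'i%C *: (x - star x).
  rewrite starZ starD starN starK.
  rewrite conj_i.
  by rewrite scaleNr -scalerN opprB.
have := star_representation_selfadjoint h1.
rewrite linearD adjD => k1.
have := star_representation_selfadjoint h2.
rewrite linearZ linearB adjZ adjB => k2.
have i0 : 'i%C != 0 :> R[i] by rewrite eq_complex /= oner_eq0 andbF.
have {}k2 : adj (a x) - adj (a (star x)) = a (star x) - a x.
  apply: (scalerI i0); apply/eqP; rewrite -subr_eq0 -[in X in _ - X]opprB scalerN opprK.
  rewrite -k2; apply/eqP.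
  rewrite conj_i.
  by rewrite scaleNr subrr.
have two : 2%:R != 0 :> R[i] by rewrite pnatr_eq0.
apply: (scalerI two); rewrite !scaler_nat !mulr2n.
have -> : a (star x) + a (star x) = a x + a (star x) + (a (star x) - a x).
  by rewrite (addrC (a x)) addrACA subrr addr0.
by rewrite -k1 -k2 addrACA subrr addr0.
Qed.

End Representation.
End CstarInvolution.
End OperatorAlgebra.

(** Log-convexity makes the ratios of consecutive terms nondecreasing, so a first ratio r > D would
    force c n >= r^n c 0, against the bound C D^n. If c 0 = 0, log-convexity already gives c 1 =
    0. *)
Lemma log_convex_bounded (R : realType) (c : nat -> R) (C D : R) :
  (forall n, 0 <= c n) -> (forall n, c n.+1 ^+ 2 <= c n * c n.+2) ->
  0 < D -> (forall n, c n <= C * D ^+ n) -> c 1%N <= D * c 0%N.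
Proof.
move=> c0 cc D0 cC; rewrite leNgt; apply/negP => h.
have c00 : 0 < c 0%N.
  rewrite lt_neqAle c0 andbT eq_sym; apply/eqP => c00; rewrite c00 mulr0 in h.
  by have := cc 0%N; rewrite c00 mul0r leNgt exprn_gt0.
pose r := c 1%N / c 0%N.
have rD : D < r by rewrite /r ltr_pdivlMr.
have r0 : 0 < r := lt_trans D0 rD.
have step n : 0 < c n /\ r * c n <= c n.+1.
  elim: n => [|n [cn IH]]; first by split=> //; rewrite /r divfK// gt_eqF.
  have cn1 : 0 < c n.+1 by apply: lt_le_trans IH; exact: mulr_gt0.
  split=> //; rewrite -(ler_pM2l cn); apply: le_trans (cc n).
  by rewrite expr2 mulrA [c n * r]mulrC ler_wpM2r.
have lb n : r ^+ n * c 0%N <= c n.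
  elim: n => [|n IH]; first by rewrite expr0 mul1r.
  by rewrite exprS -mulrA (le_trans _ (step n).2)// ler_wpM2l// ltW.
have ub n : c 0%N <= `|C| * (D / r) ^+ n.
  rewrite expr_div_n mulrA ler_pdivlMr ?exprn_gt0// mulrC.
  rewrite (le_trans (lb n))// (le_trans (cC n))// ler_wpM2r ?exprn_ge0 ?(ltW D0)//.
  exact: ler_norm.
have z1 : `|D / r| < 1 by rewrite ger0_norm ?(divr_ge0 (ltW D0) (ltW r0))// ltr_pdivrMr// mul1r.
have k0 : 0 < 1 + `|C| by rewrite ltr_pwDl.
have : \forall n \near \oo, (D / r) ^+ n < c 0%N / (1 + `|C|).
  by apply: (cvgr_lt 0); [exact: cvg_expr | rewrite divr_gt0].
move=> /(@filter_ex _ \oo _ _)[n]; rewrite ltr_pdivlMr// => hn.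
have := ub n; have z0 : 0 <= (D / r) ^+ n by rewrite exprn_ge0// (divr_ge0 (ltW D0) (ltW r0)).
by move: hn; lra.
Qed.

(** * Comparison of inner products *)

Section PositiveOperators.
Context {R : realType}.
Variables (H : hilbertType R) (D : bop H H).
Hypothesis Dsa : adj D = D.
Let c := rnorm D.

Let Dsym x y : rdot (D x) y = rdot x (D y).
Proof. by rewrite radjE Dsa. Qed.

Let c0 : 0 <= c := rnorm_ge0 D.

Let Dc x : rnorm (D x) <= c * rnorm x.
Proof. exact: rnorm_app. Qed.

(** This is D^2 <= c D, obtained without a square root of D by testing positivity at x - D x / c. *)
Lemma positive_op_sqr_le : (forall x, 0 <= rdot (D x) x) ->
  forall x, rnorm (D x) ^+ 2 <= c * rdot (D x) x.
Proof.
move=> D0 x; have [cE|cn] := eqVneq c 0.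
  have := Dc x; rewrite cE mul0r => h; rewrite mul0r.
  by have := rnorm_ge0 (D x); nra.
have cp : 0 < c by rewrite lt_neqAle eq_sym cn.
have := D0 (x - (c^-1)%:C%C *: D x).
rewrite linearB linearZ /= !(rdotBl, rdotBr, rdotZl, rdotZr) (Dsym (D x) x) rdotE.
have h : rdot (D (D x)) (D x) <= c * rnorm (D x) ^+ 2.
  by rewrite (le_trans (rdot_le _ _))// expr2 mulrA ler_wpM2r ?rnorm_ge0.
have h2 : c^-1 * (c^-1 * rdot (D (D x)) (D x)) <= c^-1 * rnorm (D x) ^+ 2.
  by rewrite ler_wpM2l ?invr_ge0// mulrC ler_pdivrMr// mulrC.
move=> h3; rewrite mulrC -ler_pdivrMr// mulrC; lra.
Qed.

(** The conclusion mentions only norms and products, so it passes from one isometric representation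
    to another, unlike positivity itself. *)
Lemma positive_op_quadratic : (forall x, 0 <= rdot (D x) x) ->
  rnorm (D \bo D - c%:C%C *: D) <= c ^+ 2.
Proof.
move=> D0; apply: rnorm_bop_le => [|x]; first exact: sqr_ge0.
rewrite -ler_sqr ?nnegrE ?mulr_ge0 ?rnorm_ge0 ?sqr_ge0//.
have -> : (D \bo D - c%:C%C *: D) x = D (D x) - c%:C%C *: D x by [].
rewrite -rdotE !(rdotBl, rdotBr, rdotZl, rdotZr) (rdotC (D x) (D (D x))) !rdotE.
have h1 := positive_op_sqr_le D0 (D x).
have h2 : rnorm (D x) ^+ 2 <= (c * rnorm x) ^+ 2.
  by rewrite ler_sqr ?nnegrE ?mulr_ge0 ?rnorm_ge0.
have h3 : c ^+ 2 * rnorm (D x) ^+ 2 <= (c ^+ 2 * rnorm x) ^+ 2.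
  have -> : (c ^+ 2 * rnorm x) ^+ 2 = c ^+ 2 * (c * rnorm x) ^+ 2 by ring.
  by rewrite ler_wpM2l ?sqr_ge0.
by have := sqr_ge0 (rnorm (D (D x))); lra.
Qed.

(** For negative D the cross term of |D^2 x - c D x|^2 has the favourable sign, and the square is at
    least 2 |D^2 x|^2. Hence |D^2| <= c^2 / sqrt 2, while |D^2| = c^2 because D is selfadjoint. *)
Lemma negative_op_quadratic : (forall x, rdot (D x) x <= 0) ->
  rnorm (D \bo D - c%:C%C *: D) <= c ^+ 2 -> D = 0.
Proof.
move=> D0 Dle; apply: rnorm_eq0; rewrite -/c.
have DD : rnorm (D \bo D) = c ^+ 2 by rewrite -{1}Dsa rnorm_adj_comp.
have key x : 2 * rnorm (D (D x)) ^+ 2 <= (c ^+ 2 * rnorm x) ^+ 2.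
  apply: (@le_trans _ _ (rnorm ((D \bo D - c%:C%C *: D) x) ^+ 2)); last first.
    by rewrite ler_sqr ?nnegrE ?mulr_ge0 ?rnorm_ge0 ?sqr_ge0 ?rnorm_app_le.
  have -> : (D \bo D - c%:C%C *: D) x = D (D x) - c%:C%C *: D x by [].
  rewrite -[leRHS]rdotE !(rdotBl, rdotBr, rdotZl, rdotZr) (rdotC (D x) (D (D x))) !rdotE.
  have h2 : rnorm (D (D x)) ^+ 2 <= (c * rnorm (D x)) ^+ 2.
    by rewrite ler_sqr ?nnegrE ?mulr_ge0 ?rnorm_ge0.
  have h3 : c * rdot (D (D x)) (D x) <= 0 by rewrite mulr_ge0_le0.
  by move: h2; rewrite exprMn; lra.
have k1 : rnorm (D \bo D) <= Num.sqrt 2^-1 * c ^+ 2.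
  apply: rnorm_bop_le => [|x]; first by rewrite mulr_ge0 ?sqrtr_ge0 ?sqr_ge0.
  rewrite -ler_sqr ?nnegrE ?mulr_ge0 ?rnorm_ge0 ?sqrtr_ge0 ?sqr_ge0//.
  rewrite -mulrA exprMn sqr_sqrtr ?invr_ge0//.
  by have := key x; rewrite [D _]/=; lra.
have s1 : Num.sqrt 2^-1 < 1 :> R.
  rewrite -(ltr_pXn2r (n := 2))// ?nnegrE ?sqrtr_ge0// sqr_sqrtr ?invr_ge0// expr1n.
  by rewrite invf_lt1 ?ltr1n.
rewrite DD in k1; have := sqr_ge0 c; have := sqrtr_ge0 (2^-1 : R) => s0 c2.
by apply/eqP; rewrite -sqrf_eq0 eq_le c2 andbT; nra.
Qed.

End PositiveOperators.

Section RiggingInnerProduct.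
Context {R : realType}.
Variables (A : opalgType R) (star : A -> A).
Hypothesis starP : is_Cstar_involution star.
Variables (Y : normedModType R[i]) (H K : hilbertType R).
Variables (a : {linear A -> bop H H}) (rho : {linear Y -> bop H K}) (ip : Y -> Y -> A).
Hypothesis aI : forall x, rnorm (a x) = rnorm x.
Hypothesis aM : forall x y, a (opmul x y) = a x \bo a y.
Hypothesis aS : forall x, a (star x) = adj (a x).
Hypothesis rhoI : forall y, rnorm (rho y) = rnorm y.
Hypothesis ipE : forall y z, a (ip y z) = adj (rho y) \bo rho z.

Let ainj := isometric_inj aI.

Lemma ip_star y z : star (ip y z) = ip z y.
Proof. by apply: ainj; rewrite aS !ipE adj_comp adjK. Qed.

Lemma rnorm_ip y : rnorm (ip y y) = rnorm y ^+ 2.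
Proof. by rewrite -aI ipE rnorm_adj_comp rhoI. Qed.

Lemma rnorm_ip_le y z : rnorm (ip y z) <= rnorm y * rnorm z.
Proof. by rewrite -aI ipE (le_trans (rnorm_bcomp _ _))// rnorm_adj !rhoI. Qed.

Lemma ipDl x y z : ip (x + y) z = ip x z + ip y z.
Proof. by apply: ainj; rewrite linearD !ipE linearD adjD bcompDl. Qed.

Lemma ipDr x y z : ip x (y + z) = ip x y + ip x z.
Proof. by apply: ainj; rewrite linearD !ipE linearD bcompDr. Qed.

Lemma ipBl x y z : ip (x - y) z = ip x z - ip y z.
Proof. by apply: ainj; rewrite linearB !ipE linearB adjB bcompBl. Qed.

Lemma ipBr x y z : ip x (y - z) = ip x y - ip x z.
Proof. by apply: ainj; rewrite linearB !ipE linearB bcompBr. Qed.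

Lemma ipZl c x y : ip (c *: x) y = Num.conj c *: ip x y.
Proof. by apply: ainj; rewrite linearZ /= !ipE linearZ /= adjZ bcompZl. Qed.

Lemma ipZr c x y : ip x (c *: y) = c *: ip x y.
Proof. by apply: ainj; rewrite linearZ /= !ipE linearZ /= bcompZr. Qed.

Lemma rdot_ip y z u v : rdot (a (ip y z) u) v = rdot (rho z u) (rho y v).
Proof. by rewrite ipE; rewrite [LHS]rdotC [RHS]rdotC [RHS]radjE. Qed.

Lemma ip_eq0 y : ip y y = 0 -> y = 0.
Proof.
move=> h; apply: rnorm_eq0; apply/eqP; rewrite -sqrf_eq0 -rnorm_ip h rnorm0.
exact: eqxx.
Qed.

End RiggingInnerProduct.

Lemma ip_polarization (R : realType) (A : opalgType R) (Y : normedModType R[i])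
    (ip ip' : Y -> Y -> A) :
  (forall x y z, ip (x + y) z = ip x z + ip y z) ->
  (forall x y z, ip x (y + z) = ip x y + ip x z) ->
  (forall c x y, ip (c *: x) y = Num.conj c *: ip x y) ->
  (forall c x y, ip x (c *: y) = c *: ip x y) ->
  (forall x y z, ip' (x + y) z = ip' x z + ip' y z) ->
  (forall x y z, ip' x (y + z) = ip' x y + ip' x z) ->
  (forall c x y, ip' (c *: x) y = Num.conj c *: ip' x y) ->
  (forall c x y, ip' x (c *: y) = c *: ip' x y) ->
  (forall y, ip y y = ip' y y) -> forall y z, ip y z = ip' y z.
Proof.
move=> Dl Dr Zl Zr Dl' Dr' Zl' Zr' ipy.
have sym y z : ip y z + ip z y = ip' y z + ip' z y.
  have := ipy (y + z); rewrite Dl !Dr Dl' !Dr' !ipy => h.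
  have {}h : ip' y y + (ip y z + ip z y) + ip' z z = ip' y y + (ip' y z + ip' z y) + ip' z z.
    by move: h; rewrite !addrA.
  by move/addIr/addrI: h.
move=> y z; have h1 := sym y z; have := sym y ('i%C *: z).
rewrite Zl Zr Zl' Zr'.
rewrite conj_i.
rewrite !scaleNr -!scalerBr => h2.
have i0 : 'i%C != 0 :> R[i] by rewrite eq_complex /= oner_eq0 andbF.
move/(scalerI i0) in h2.
have two : 2%:R != 0 :> R[i] by rewrite pnatr_eq0.
apply: (scalerI two); rewrite !scaler_nat !mulr2n.
have e1 (p q : A) : p + p = p + q + (p - q) by rewrite addrACA subrr addr0.
by rewrite (e1 (ip y z) (ip z y)) h1 h2 -e1.
Qed.

Section Comparison.
Context {R : realType}.
Variables (A : opalgType R) (star : A -> A).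
Hypothesis starP : is_Cstar_involution star.
Variables (Y : normedModType R[i]) (H K H' K' : hilbertType R).
Variables (a : {linear A -> bop H H}) (rho : {linear Y -> bop H K}) (ip : Y -> Y -> A).
Hypothesis aI : forall x, rnorm (a x) = rnorm x.
Hypothesis aS : forall x, a (star x) = adj (a x).
Hypothesis rhoI : forall y, rnorm (rho y) = rnorm y.
Hypothesis ipE : forall y z, a (ip y z) = adj (rho y) \bo rho z.
Variables (a' : {linear A -> bop H' H'}) (rho' : {linear Y -> bop H' K'}) (ip' : Y -> Y -> A).
Hypothesis aI' : forall x, rnorm (a' x) = rnorm x.
Hypothesis aS' : forall x, a' (star x) = adj (a' x).
Hypothesis rhoI' : forall y, rnorm (rho' y) = rnorm y.
Hypothesis ipE' : forall y z, a' (ip' y z) = adj (rho' y) \bo rho' z.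

(* If a contraction T of Y has an adjoint T# from (Y, ip') to (Y, ip), then
   S = T# T is a contraction that is selfadjoint for ip, so n |-> |rho (S^n y) xi|
   is log-convex and bounded; hence |rho (S y) xi| <= |rho y xi|. *)
Lemma ip_contraction (T T' : Y -> Y) y (xi : H) :
  (forall y, rnorm (T y) <= rnorm y) ->
  (forall y z, ip' (T y) z = ip y (T' z)) ->
  rdot (a (ip' (T y) (T y)) xi) xi <= rdot (a (ip y y) xi) xi.
Proof.
move=> T1 TT'; pose S z := T' (T z).
have SE y1 z : ip y1 (S z) = ip' (T y1) (T z) by rewrite /S -TT'.
have Ssym y1 z : ip (S y1) z = ip y1 (S z).
  by rewrite -(ip_star aI aS ipE) SE (ip_star aI' aS' ipE') -SE.
have S1 z : rnorm (S z) <= rnorm z.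
  have : rnorm (S z) ^+ 2 <= rnorm (S z) * rnorm z.
    rewrite -(rnorm_ip aI rhoI ipE) SE.
    rewrite (le_trans (rnorm_ip_le aI' rhoI' ipE' _ _))//.
    by rewrite ler_pM ?rnorm_ge0.
  have := rnorm_ge0 (S z); have := rnorm_ge0 z; rewrite expr2; nra.
pose N z := rnorm (rho z xi).
have Nlog z : N (S z) ^+ 2 <= N z * N (S (S z)).
  by rewrite /N -rdotE -(rdot_ip ipE) Ssym (rdot_ip ipE) mulrC rdot_le.
have NS : N (S y) <= N y.
  rewrite -[leRHS]mul1r.
  apply: (@log_convex_bounded _ (fun n => N (iter n S y)) (rnorm y * rnorm xi)) => // n.
  - exact: rnorm_ge0.
  - exact: Nlog.
  - rewrite expr1n mulr1 /N (le_trans (rnorm_app _ _))// rhoI ler_wpM2r ?rnorm_ge0//.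
    by elim: n => //= n; apply: le_trans.
rewrite -SE !(rdot_ip ipE) (le_trans (rdot_le _ _))// rdotE expr2.
by rewrite ler_wpM2r ?rnorm_ge0.
Qed.

Lemma ip_le (I : Type) (F : set_system I) (T T' : I -> Y -> Y) :
  ProperFilter F ->
  (forall t y, rnorm (T t y) <= rnorm y) ->
  (forall t y z, ip' (T t y) z = ip y (T' t z)) ->
  (forall y, T t y @[t --> F] --> y) ->
  forall y (xi : H), rdot (a (ip' y y) xi) xi <= rdot (a (ip y y) xi) xi.
Proof.
move=> FF T1 TT' Tc y xi; apply/ler_addgt0Pr => d d0.
pose k := 1 + 2 * rnorm y * rnorm xi ^+ 2.
have k0 : 0 < k by rewrite ltr_pwDl// !mulr_ge0 ?rnorm_ge0.
have h : \forall t \near F, rnorm (T t y - y) < d / k.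
  by apply: (cvg_rnormP.1 (@Tc y)); rewrite divr_gt0.
have [t ht] := filter_ex h; rewrite ltr_pdivlMr// in ht.
have := ip_contraction y xi (T1 t) (TT' t).
set z := T t y in ht *.
have -> : rdot (a (ip' y y) xi) xi = rdot (a (ip' z z) xi) xi +
    rdot (a (ip' y y - ip' z z) xi) xi.
  by rewrite -rdotDl linearB [in RHS]/= addrC subrK.
suff : rdot (a (ip' y y - ip' z z) xi) xi <= d by move=> h1 h2; rewrite lerD.
have -> : ip' y y - ip' z z = ip' (y - z) y + ip' z (y - z).
  by rewrite (ipBl aI' ipE') (ipBr aI' ipE') addrA subrK.
rewrite (le_trans (rdot_le _ _))//.
rewrite (@le_trans _ _ ((rnorm (z - y) * rnorm y + rnorm y * rnorm (z - y)) * rnorm xi * rnorm xi))//.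
  rewrite ler_wpM2r ?rnorm_ge0//; apply: rnorm_app_le; rewrite aI.
  rewrite (le_trans (rnormD _ _))// lerD//.
    by rewrite rnormBC (rnorm_ip_le aI' rhoI' ipE').
  rewrite (le_trans (rnorm_ip_le aI' rhoI' ipE' _ _))// (rnormBC y z).
  by rewrite ler_wpM2r ?rnorm_ge0//; exact: T1.
move: ht; rewrite /k; have := rnorm_ge0 (z - y); have := rnorm_ge0 y.
by have := rnorm_ge0 xi; lra.
Qed.

End Comparison.

(** * Riggings *)

Section SequentialCompleteness.
Context {R : realType}.

(** A property rather than a structure, so that it can be proved both for complete modules and for
    [bop V W]. *)
Definition seq_complete (V : normedModType R[i]) : Prop :=
  forall (u : nat -> V) (r : nat -> R), r @ \oo --> (0 : R) ->
  (forall m n, rnorm (u m - u n) <= r m + r n) -> exists x : V, u @ \oo --> x.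

Lemma complete_seq_complete (V : completeNormedModType R[i]) : seq_complete V.
Proof. by move=> u r r0 ur; exists (limn u); exact: cvg_seq_rnorm r0 ur. Qed.

Lemma bop_seq_complete (V : normedModType R[i]) (W : completeNormedModType R[i]) :
  seq_complete (bop V W).
Proof.
move=> u r r0 ur.
have urx x m n : rnorm (u m x - u n x) <= r m * rnorm x + r n * rnorm x.
  by rewrite -mulrDl; apply: rnorm_app_le (ur m n).
have lim x : exists l : W, u n x @[n --> \oo] --> l.
  apply: (complete_seq_complete _ (urx x)).
  by rewrite -[X in _ --> X](mul0r (rnorm x)); apply: cvgMl.
have [L uL] := choice lim.
have L_le n x : rnorm (u n x - L x) <= r n * rnorm x.
  apply/ler_addgt0Pr => d d0; have d2 : 0 < d / 2 by rewrite divr_gt0.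
  have k0 : 0 < 1 + rnorm x by rewrite ltr_pwDl ?rnorm_ge0.
  have h1 : \forall m \near \oo, rnorm (u m x - L x) < d / 2.
    by apply: (cvg_rnormP.1 (@uL x)).
  have h2 : \forall m \near \oo, r m < d / 2 / (1 + rnorm x).
    by apply: (cvgr_lt 0) => //; rewrite divr_gt0.
  have [m [{}h1]] := @filter_ex _ \oo _ _ (filterI h1 h2).
  rewrite ltr_pdivlMr// => {}h2.
  rewrite (le_trans (rnorm_trans (u m x) _ _))// [d in leRHS]splitr addrA lerD ?(ltW h1)//.
  rewrite (le_trans (urx _ _ _))// lerD2l (le_trans _ (ltW h2))//.
  have : 0 <= r m + r m by rewrite (le_trans (rnorm_ge0 _) (ur m m)).
  by have := rnorm_ge0 x; nra.
have [c x y|x|T TL] := @mkbop _ _ _ L (rnorm (u 0%N) + r 0%N).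
- have h1 := @uL (c *: x + y).
  have h2 : u n (c *: x + y) @[n --> \oo] --> c *: L x + L y.
    rewrite (_ : (fun n => _) = (fun n => c *: u n x + u n y)).
      by apply: cvgD; [apply: cvgZr; exact: uL | exact: uL].
    by apply/funext => n; rewrite linearP.
  exact: cvg_unique h1 h2.
- rewrite (le_trans (rnorm_le_sub _ (u 0%N x)))// mulrDl lerD ?rnorm_app//.
  by rewrite rnormBC.
exists T; apply/cvg_rnormP => d d0.
have : \forall n \near \oo, r n < d by apply: (cvgr_lt 0).
apply: filterS => n; apply: le_lt_trans; apply: rnorm_bop_le => [|x].
  have : 0 <= r n + r n by rewrite (le_trans (rnorm_ge0 _) (ur n n)).
  lra.
by have := L_le n x; rewrite -TL.
Qed.

(** Linearity and isometry are asked only on S because the map [lift] below has them only on B.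
    Completeness is asked of the source, where the preimages of an approximating sequence are
    Cauchy. *)
Lemma image_closed_subspace (V W : normedModType R[i]) (S : set V) (f : V -> W) :
  seq_complete V -> closed_subspace S ->
  (forall c x y, S x -> S y -> f (c *: x + y) = c *: f x + f y) ->
  (forall x, S x -> rnorm (f x) = rnorm x) -> closed_subspace (f @` S).
Proof.
move=> Vc Ss fl fI; have S0 := Ss.1.1.
have fB x y : S x -> S y -> f (x - y) = f x - f y.
  by move=> Sx Sy; rewrite addrC -scaleN1r fl// scaleN1r addrC.
split; first split.
- exists 0 => //; apply: rnorm_eq0; rewrite fI// rnorm0 //.
- move=> c _ _ [x Sx <-] [y Sy <-]; exists (c *: x + y); last exact: fl.
  exact: Ss.1.2.
- apply: closed_rnormW => w h.
  have ex (n : nat) : exists v, S v /\ rnorm (w - f v) < n.+1%:R^-1.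
    have [|_ [v Sv <-] wv] := h n.+1%:R^-1; first by rewrite invr_gt0 ltr0n.
    by exists v.
  have [v vP] := choice ex.
  have hc : (n.+1%:R^-1 : R) @[n --> \oo] --> (0 : R) by exact: cvg_harmonic.
  have [m n|x vx] := Vc v _ hc.
    have [Sm wm] := vP m; have [Sn wn] := vP n.
    rewrite -fI; last exact: subspaceB Ss.1 _ _.
    rewrite fB// (le_trans (rnorm_trans w _ _))// lerD//; last exact: ltW.
    by rewrite rnormBC ltW.
  have Sx : S x by apply: closed_subspace_cvg Ss _ vx => n; case: (vP n).
  exists x => //; apply/eqP; rewrite -subr_eq0; apply/eqP/rnorm_lt_eps => d d0.
  have d2 : 0 < d / 2 by rewrite divr_gt0.
  have h1 : \forall n \near \oo, rnorm (v n - x) < d / 2 by exact: cvg_rnormP.1 vx _ d2.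
  have h2 : \forall n \near \oo, n.+1%:R^-1 < d / 2 :> R by apply: (cvgr_lt 0).
  have [n [{}h1 {}h2]] := @filter_ex _ \oo _ _ (filterI h1 h2).
  have [Sn wn] := vP n.
  rewrite (le_trans (rnorm_trans (f (v n)) _ _))// [leRHS]splitr lerD//.
    by rewrite -fB// fI 1?rnormBC ?(ltW h1)//; exact: subspaceB Ss.1 _ _.
  by rewrite rnormBC (le_trans (ltW wn)) ?(ltW h2).
Qed.

Lemma closed_subspaceT (V : normedModType R[i]) : closed_subspace [set: V].
Proof. by split; [|exact: closedT]. Qed.

Lemma cvg_isometry (V W : normedModType R[i]) (f : {linear V -> W}) (T : Type)
    (F : set_system T) {FF : Filter F} (u : T -> V) (x : V) :
  (forall v, rnorm (f v) = rnorm v) -> f (u t) @[t --> F] --> f x <-> u @ F --> x.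
Proof.
move=> fI; split=> /cvg_rnormP h; apply/cvg_rnormP => d d0.
  by near=> t; rewrite -fI linearB; near: t; exact: h.
by near=> t; rewrite -linearB fI; near: t; exact: h.
Unshelve. all: by end_near. Qed.

End SequentialCompleteness.

Section RiggingFacts.
Context {R : realType}.
Variables (A : opalgType R) (Y : rightOpModType A) (H K : hilbertType R).
Variables (a : {linear A -> bop H H}) (M : set (bop H K)) (rho : {linear Y -> bop H K}).
Hypothesis rig : is_rigging a M rho.

Lemma rigging_isometry x : rnorm (a x) = rnorm x.
Proof. by case: rig => [[h _]] _ _ _ _; exact: completely_isometric_rnorm. Qed.

Lemma riggingM x y : a (opmul x y) = a x \bo a y.
Proof. by case: rig => [[]]. Qed.

Lemma rigging_module_isometry y : rnorm (rho y) = rnorm y.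
Proof. by case: rig => _ _ _ [h _] _; exact: completely_isometric_rnorm. Qed.

Lemma rigging_ract y x : rho (ract y x) = rho y \bo a x.
Proof. by case: rig. Qed.

Lemma rigging_range : range rho = cspan (bprod M (range a)).
Proof. by case: rig => _ _ _ []. Qed.

Lemma rigging_range_closed : closed_subspace (range a).
Proof.
apply: image_closed_subspace.
- exact: complete_seq_complete.
- exact: closed_subspaceT.
- by move=> c x y _ _; rewrite linearP.
- by move=> x _; exact: rigging_isometry.
Qed.

Lemma rigging_rangeM x y : range a x -> range a y -> range a (x \bo y).
Proof. by move=> [b _ <-] [c _ <-]; exists (opmul b c) => //; rewrite riggingM. Qed.

Lemma rigging_range_TRO m n x :
  M m -> M n -> range a x -> range a (adj m \bo n \bo x).
Proof.
case: rig => _ _ h _ _ Mm Mn ax; apply: h; exists (adj m \bo n); last by exists x.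
by exists (adj m); [exists m | exists n].
Qed.

Lemma rigging_memW m x : M m -> exists y, rho y = m \bo a x.
Proof.
move=> Mm; have : range rho (m \bo a x).
  by rewrite rigging_range; apply: mem_cspan_bprod => //; exists x.
by case=> y _ <-; exists y.
Qed.

Lemma rigging_adjM m y : M m -> exists x, a x = adj m \bo rho y.
Proof.
move=> Mm; have : range a (adj m \bo rho y).
  apply: (adjM_W rigging_range_closed rigging_range_TRO Mm).
  by rewrite -rigging_range; exists y.
by case=> x _ <-; exists x.
Qed.

Variables (I : Type) (F : set_system I) (e : I -> A).
Hypothesis FF : ProperFilter F.
Hypothesis e1 : forall t, rnorm (e t) <= 1.
Hypothesis el : forall x, opmul (e t) x @[t --> F] --> x.
Hypothesis er : forall x, opmul x (e t) @[t --> F] --> x.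

Lemma rigging_cai_l x : range a x -> a (e t) \bo x @[t --> F] --> x.
Proof.
move=> [b _ <-]; rewrite (_ : (fun t => _) = (fun t => a (opmul (e t) b))).
  by apply/cvg_isometry; [exact: rigging_isometry | exact: el].
by apply/funext => t; rewrite riggingM.
Qed.

Lemma rigging_cai_r x : range a x -> x \bo a (e t) @[t --> F] --> x.
Proof.
move=> [b _ <-]; rewrite (_ : (fun t => _) = (fun t => a (opmul b (e t)))).
  by apply/cvg_isometry; [exact: rigging_isometry | exact: er].
by apply/funext => t; rewrite riggingM.
Qed.

Variable star : A -> A.
Hypothesis starP : is_Cstar_involution star.

Lemma rigging_star x : a (star x) = adj (a x).
Proof.
exact: (isometric_representation_star starP rigging_isometry riggingM FF e1 el er).
Qed.

Lemma rigging_range_adj x : range a x -> range a (adj x).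
Proof. by move=> [b _ <-]; exists (star b) => //; rewrite rigging_star. Qed.

(** [rigging_ip] is a choice, so the point is that the product lies in the range of a. On a
    generator m x it equals x^* times m^* rho(z); the second factor is in the range by
    [rigging_adjM], the first because a respects the involution. *)
Lemma rigging_ipE y z : a (rigging_ip a rho y z) = adj (rho y) \bo rho z.
Proof.
rewrite /rigging_ip; case: xgetP => [x -> //|/= none]; exfalso.
have [x _ xE] : range a (adj (rho y) \bo rho z); last exact: (none x).
have : range rho (rho y) by exists y.
rewrite rigging_range; move: (rho y).
apply: W_min => [|m x Mm ax].
  by apply: (closed_subspace_adj (C := [set S | range a (S \bo rho z)]));
    exact: closed_subspace_compr rigging_range_closed.
rewrite /= adj_comp -bcompA; apply: rigging_rangeM; first exact: rigging_range_adj.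
by have [b <-] := rigging_adjM z Mm; exists b.
Qed.

(* T y = F (rho y) for the compressions F = \sum_i p_i a(e) p_i^*, read through
   the rigging; T' is its adjoint from (Y, ip') to (Y, ip). *)
Lemma rigging_approximation (ip' : Y -> Y -> A) (H' K' : hilbertType R)
    (a' : {linear A -> bop H' H'}) (rho' : {linear Y -> bop H' K'}) :
  (forall x, rnorm (a' x) = rnorm x) ->
  (forall x y, a' (opmul x y) = a' x \bo a' y) ->
  (forall x, a' (star x) = adj (a' x)) ->
  (forall y x, rho' (ract y x) = rho' y \bo a' x) ->
  (forall y z, a' (ip' y z) = adj (rho' y) \bo rho' z) ->
  exists T T' : nat * I -> Y -> Y,
  [/\ forall t y, rnorm (T t y) <= rnorm y,
      forall t y z, ip' (T t y) z = rigging_ip a rho y (T' t z)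
    & forall y, T t y @[t --> iter_filter F] --> y].
Proof.
move=> aI' aM' aS' ract' ipE'.
case: rig => _ [_ _ [p [q [pqM pm _ P1 _]]]] _ _ _.
have pM i : M (p i) by case: (pqM i).
have {}P1 n : rnorm (\sum_(i < n) (p i \bo adj (p i))) <= 1 by rewrite rnorm_le1; exact: P1.
have exu (it : nat * I) : exists y, rho y = p it.1 \bo a (e it.2) by exact: rigging_memW.
have exg (iy : nat * Y) : exists x, a x = adj (p iy.1) \bo rho iy.2 by exact: rigging_adjM.
have exv (ix : nat * A) : exists y, rho y = p ix.1 \bo a ix.2 by exact: rigging_memW.
have [u uE] := choice exu; have [g gE] := choice exg; have [v vE] := choice exv.
(* As p_i a(e) = rho(u_i) and p_i^* rho(y) = a(g_i), T can be written with the module action alone.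
   This makes it computable under rho' as well, where it becomes the sum of rho'(u_i) a'(g_i). *)
pose T (nt : nat * I) y := \sum_(i < nt.1) ract (u (nat_of_ord i, nt.2)) (g (nat_of_ord i, y)).
pose T' (nt : nat * I) z := \sum_(i < nt.1) v (nat_of_ord i, ip' (u (nat_of_ord i, nt.2)) z).
have TE nt y : rho (T nt y) = compression (a \o e) p nt \bo rho y.
  rewrite /T linear_sum bcomp_suml; apply: eq_bigr => i _.
  by rewrite rigging_ract uE gE /= !bcompA.
exists T, T'; split.
- move=> nt y; rewrite -rigging_module_isometry TE -[leRHS]rigging_module_isometry.
  apply: rnorm_bcomp_le1l; apply: compression_le1 => // t.
  by rewrite /= rigging_isometry.
- move=> nt y z.
  pose s := \sum_(i < nt.1) opmul (star (g (nat_of_ord i, y))) (ip' (u (nat_of_ord i, nt.2)) z).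
  transitivity s.
    apply: (isometric_inj aI'); rewrite ipE' linear_sum adj_sum bcomp_suml linear_sum.
    by apply: eq_bigr => i _; rewrite ract' adj_comp aM' aS' ipE' bcompA.
  apply: (isometric_inj rigging_isometry); rewrite rigging_ipE !linear_sum bcomp_sumr.
  apply: eq_bigr => i _; rewrite riggingM rigging_star gE vE /=.
  by rewrite adj_comp adjK bcompA.
- move=> y; apply: (@cvg_isometry _ _ _ rho _ _ _ (T^~ y) y rigging_module_isometry).1.
  rewrite (_ : (fun nt => _) = (fun nt => compression (a \o e) p nt \bo rho y)).
    apply: (compression_W rigging_range_closed rigging_range_TRO FF _ pM pm P1).
      by move=> x; exact: rigging_cai_l.
    by rewrite -rigging_range; exists y.
  by apply/funext => nt; rewrite TE.
Qed.

End RiggingFacts.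

(** * Independence of the inner product from the rigging *)

Section RiggingIndependence.
Context {R : realType}.
Variables (A : opalgType R) (Y : rightOpModType A) (star : A -> A).
Hypothesis starP : is_Cstar_involution star.
Variables (I : Type) (F : set_system I) (e : I -> A).
Hypothesis FF : ProperFilter F.
Hypothesis e1 : forall t, rnorm (e t) <= 1.
Hypothesis el : forall x, opmul (e t) x @[t --> F] --> x.
Hypothesis er : forall x, opmul x (e t) @[t --> F] --> x.

Lemma rigging_ip_le (H K H' K' : hilbertType R)
    (a : {linear A -> bop H H}) (M : set (bop H K)) (rho : {linear Y -> bop H K})
    (a' : {linear A -> bop H' H'}) (M' : set (bop H' K')) (rho' : {linear Y -> bop H' K'}) :
  is_rigging a M rho -> is_rigging a' M' rho' -> forall y xi,
  rdot (a (rigging_ip a' rho' y y) xi) xi <= rdot (a (rigging_ip a rho y y) xi) xi.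
Proof.
move=> rig rig' y xi.
have ipE := rigging_ipE rig FF e1 el er starP.
have ipE' := rigging_ipE rig' FF e1 el er starP.
have aS := rigging_star rig FF e1 el er starP.
have aS' := rigging_star rig' FF e1 el er starP.
have [T [T' [T1 TT' Tc]]] := rigging_approximation rig FF e1 el er starP
  (rigging_isometry rig') (riggingM rig') aS' (rigging_ract rig') ipE'.
exact: (ip_le (rigging_isometry rig) aS (rigging_module_isometry rig) ipE
  (rigging_isometry rig') aS' (rigging_module_isometry rig') ipE' _ T1 TT' Tc).
Qed.

Lemma rigging_ip_unique (H K H' K' : hilbertType R)
    (a : {linear A -> bop H H}) (M : set (bop H K)) (rho : {linear Y -> bop H K})
    (a' : {linear A -> bop H' H'}) (M' : set (bop H' K')) (rho' : {linear Y -> bop H' K'}) :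
  is_rigging a M rho -> is_rigging a' M' rho' ->
  rigging_ip a' rho' = rigging_ip a rho.
Proof.
move=> rig rig'.
have ipE := rigging_ipE rig FF e1 el er starP.
have ipE' := rigging_ipE rig' FF e1 el er starP.
have aS := rigging_star rig FF e1 el er starP.
have aS' := rigging_star rig' FF e1 el er starP.
have aI := rigging_isometry rig; have aI' := rigging_isometry rig'.
apply/funext => y; apply/funext => z; apply/esym.
apply: (ip_polarization (ipDl aI ipE) (ipDr aI ipE) (ipZl aI ipE) (ipZr aI ipE)
  (ipDl aI' ipE') (ipDr aI' ipE') (ipZl aI' ipE') (ipZr aI' ipE')) => {y z} y.
apply/eqP; rewrite -subr_eq0; apply/eqP.
set d := _ - _.
have dd : star d = d.
  by rewrite /d starD// starN// (ip_star aI aS ipE) (ip_star aI' aS' ipE').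
apply: (isometric_inj aI'); rewrite linear0.
have D0 xi : 0 <= rdot (a d xi) xi.
  by rewrite /d linearB [bop_fun _ _]/= rdotBl subr_ge0; exact: (rigging_ip_le rig rig').
have D0' xi : rdot (a' d xi) xi <= 0.
  by rewrite /d linearB [bop_fun _ _]/= rdotBl subr_le0; exact: (rigging_ip_le rig' rig).
(* The norm of d^2 - |d| d is computed in A, so the bound given by positivity under a is available
   under a'. *)
apply: negative_op_quadratic => //; first by rewrite -aS' dd.
rewrite aI' -(riggingM rig') -linearZ -linearB aI' -aI linearB linearZ /= (riggingM rig).
by rewrite -(aI d); apply: positive_op_quadratic => //; rewrite -aS dd.
Qed.

End RiggingIndependence.

(** * Doubly rigged modules *)

Section DoubleRigging.
Context {R : realType}.
Variables (A : opalgType R) (Y : rightOpModType A) (H K : hilbertType R).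
Variables (a : {linear A -> bop H H}) (M : set (bop H K)) (rho : {linear Y -> bop H K}).
Hypothesis rig : is_rigging a M rho.
Local Notation A0 := (cspan (bprod (bprod (@adj R H K @` M) M) (range a))).
Local Notation B := (cspan (bprod (bprod M (range a)) (@adj R H K @` M))).
Hypothesis double : A0 = cspan (bprod (range a) (bprod (@adj R H K @` M) M)).
Variables (I : Type) (F : set_system I) (e : I -> A).
Hypothesis FF : ProperFilter F.
Hypothesis e1 : forall t, rnorm (e t) <= 1.
Hypothesis el : forall x, opmul (e t) x @[t --> F] --> x.
Hypothesis er : forall x, opmul x (e t) @[t --> F] --> x.
Variable star : A -> A.
Hypothesis starP : is_Cstar_involution star.

Let RAs := rigging_range_closed rig.
Let RAm := rigging_rangeM rig.
Let MMA := rigging_range_TRO rig.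
Let RAadj := rigging_range_adj rig FF e1 el er starP.
Let aI := rigging_isometry rig.
Let ainj := isometric_inj aI.
Let rhoI := rigging_module_isometry rig.
Let rhoinj := isometric_inj rhoI.
Let aS := rigging_star rig FF e1 el er starP.
Let ip := rigging_ip a rho.
Let ipE : forall y z, a (ip y z) = adj (rho y) \bo rho z :=
  rigging_ipE rig FF e1 el er starP.
Let A0s := @cspan_closed_subspace R _ (bprod (bprod (@adj R H K @` M) M) (range a)).
Let Bs := @cspan_closed_subspace R _ (bprod (bprod M (range a)) (@adj R H K @` M)).

Lemma rho_min (C : set (bop H K)) : closed_subspace C ->
  (forall m x, M m -> range a x -> C (m \bo x)) -> forall y, C (rho y).
Proof.
move=> Cs h y; have : range rho (rho y) by exists y.
by rewrite (rigging_range rig); apply: W_min.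
Qed.

Lemma A0_adj x : A0 x -> A0 (adj x).
Proof.
move: x; apply: A0_min => [|m n x Mm Mn ax]; first exact: closed_subspace_adj.
rewrite /= !adj_comp adjK; apply: (mem_A0r double) => //; exact: RAadj.
Qed.

Lemma A0_ip y z : A0 (adj (rho y) \bo rho z).
Proof.
apply: (rho_min (C := [set T | A0 (adj T \bo rho z)])) => [|m x Mm ax].
  by apply: (closed_subspace_adj (C := [set S | A0 (S \bo rho z)]));
    exact: closed_subspace_compr.
apply: (rho_min (C := [set S | A0 (adj (m \bo x) \bo S)])) => [|n w Mn aw].
  exact: closed_subspace_compl.
rewrite /= adj_comp -bcompA; apply: (RA_A0 RAm double); first exact: RAadj.
by rewrite bcompA; exact: mem_A0.
Qed.

(** Left multiplication by a(e_t) turns m^* n x into rho(y)^* rho(z), with rho(y) = m a(e_t)^* and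
    rho(z) = n x, and is harmless in the limit. So A0 is spanned by inner products. *)
Lemma A0_min_ip (C : set (bop H H)) : closed_subspace C ->
  (forall y z, C (adj (rho y) \bo rho z)) -> A0 `<=` C.
Proof.
move=> Cs h x A0x.
apply: (@closed_subspace_cvg _ _ C _ F _ (fun t => a (e t) \bo x)) => // [t|]; last first.
  apply: (rigging_cai_l rig FF el); exact: (A0_sub_RA RAs MMA).
move: x A0x; apply: A0_min => [|m n x Mm Mn ax]; first exact: closed_subspace_compl.
have [b _ <-] := ax.
have [y yE] := rigging_memW rig (star (e t)) Mm; have [z zE] := rigging_memW rig b Mn.
by have := h y z; rewrite yE zE adj_comp -aS (starK starP) !bcompA.
Qed.

Lemma A0_star_isomorphic :
  star_isomorphic (@bcomp R H H H) (@adj R H H) A0 (@opmul R A) star (ip_ideal ip).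
Proof.
have [il ic] := @cspan_closed_subspace R _ [set ip y z | y in setT & z in setT].
have A0ip b : ip_ideal ip b -> A0 (a b).
  move: b; apply: cspan_min => [|_ [y _ [z _ <-]]]; last by rewrite /= ipE; exact: A0_ip.
  apply: (@closed_subspace_preimage _ _ _ id a _ 1) => // [c x y|x].
    by rewrite linearP.
  by rewrite mul1r aI.
have ipA0 : A0 `<=` a @` ip_ideal ip.
  apply: A0_min_ip => [|y z].
    apply: image_closed_subspace => //; first exact: complete_seq_complete.
    by move=> c x y _ _; rewrite linearP.
  exists (ip y z); last exact: ipE.
  by apply: sub_cspan; exists y => //; exists z.
pose f x := xget 0 [set b | a b = x].
have fa b : f (a b) = b.
  by rewrite /f; case: xgetP => [c _ /ainj//|/(_ b)/= h]; exfalso; exact: h.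
have af x : A0 x -> a (f x) = x by move=> /ipA0[b _ <-]; rewrite fa.
split; first exact: A0_adj.
exists f; split.
- split.
  + by move=> x /ipA0[b ib <-]; rewrite /= fa.
  + by move=> x y /set_mem/af {2}<- /set_mem/af {2}<- ->.
  + by move=> b ib; exists (a b); [exact: A0ip | exact: fa].
- move=> c x y A0x A0y; apply: ainj; rewrite linearP !af//.
  exact: A0s.1.2.
- move=> x y A0x A0y; apply: ainj; rewrite (riggingM rig) !af//.
  by have [_ _] := A0_operator_algebra RAs RAm MMA double; apply.
- by move=> x A0x; apply: ainj; rewrite aS !af//; exact: A0_adj.
Qed.

Lemma B_adj b : B b -> B (adj b).
Proof.
move: b; apply: B_min => [|m x n Mm ax Mn]; first exact: closed_subspace_adj.
by rewrite /= !adj_comp adjK bcompA; apply: mem_B => //; exact: RAadj.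
Qed.

Lemma B_rank1 y z : B (rho y \bo adj (rho z)).
Proof.
apply: (rho_min (C := [set T | B (T \bo adj (rho z))])) => [|m x Mm ax].
  exact: closed_subspace_compr.
apply: (rho_min (C := [set S | B (m \bo x \bo adj S)])) => [|n w Mn aw].
  apply: (closed_subspace_adj (C := [set S | B (m \bo x \bo S)])).
  exact: closed_subspace_compl.
rewrite /= adj_comp bcompA -(bcompA m); apply: mem_B => //; apply: RAm => //.
exact: RAadj.
Qed.

(** As in [A0_min_ip], but with a(e_t) inserted between x and n^*, where it is absorbed into n. *)
Lemma B_min_rank1 (C : set (bop K K)) : closed_subspace C ->
  (forall y z, C (rho y \bo adj (rho z))) -> B `<=` C.
Proof.
move=> Cs h; apply: B_min => // m x n Mm ax Mn.
apply: (@closed_subspace_cvg _ _ C _ F _ (fun t => m \bo (x \bo a (e t)) \bo adj n)) => //.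
  move=> t; have [b _ <-] := ax.
  have [y yE] := rigging_memW rig b Mm.
  have [z zE] := rigging_memW rig (star (e t)) Mn.
  by have := h y z; rewrite yE zE adj_comp -aS (starK starP) !bcompA.
by apply: cvg_compr; apply: cvg_compl; exact: (rigging_cai_r rig FF er).
Qed.

Lemma B_rho b y : B b -> exists z, rho z = b \bo rho y.
Proof.
move=> Bb; have : range rho (b \bo rho y).
  rewrite (rigging_range rig); apply: (B_W RAs RAm MMA Bb).
  by rewrite -(rigging_range rig); exists y.
by case=> z _ <-; exists z.
Qed.

(* S = T^* T moves only the vectors in the closed span of rho(Y) H, and on
   that span n |-> |S^n xi| is log-convex and O((|T| C)^n). *)
Lemma B_norm_le T (C : R) : B T -> 0 < C ->
  (forall y, rnorm (T \bo rho y) <= C * rnorm y) -> rnorm T <= C.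
Proof.
move=> BT C0 hT.
have [T0|T0] := eqVneq (rnorm T) 0; first by rewrite T0 ltW.
have {}T0 : 0 < rnorm T by rewrite lt_neqAle eq_sym T0 rnorm_ge0.
have [S SE] : exists S, S = adj T \bo T by exists (adj T \bo T).
pose D := rnorm T * C; have D0 : 0 < D by exact: mulr_gt0.
have BS : B S.
  by rewrite SE; have [_ _] := B_operator_algebra RAs RAm MMA; apply => //; exact: B_adj.
have Ssa : adj S = S by rewrite SE adj_comp adjK.
have Sy y : rnorm (S \bo rho y) <= D * rnorm y.
  rewrite SE -bcompA (le_trans (rnorm_bcomp _ _))// rnorm_adj /D -mulrA.
  by rewrite ler_wpM2l ?rnorm_ge0.
pose G : set K := [set xi | exists k, forall n, rnorm (iter n S xi) <= k * D ^+ n].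
have iterD n xi eta c : iter n S (c *: xi + eta) = c *: iter n S xi + iter n S eta.
  by elim: n => [//|n IH]; rewrite !iterS IH linearP.
have Gl : linear_subspace G.
  split.
    exists 0 => n; rewrite mul0r.
    suff -> : iter n S 0 = 0 by rewrite rnorm0.
    by elim: n => [//|n IH]; rewrite iterS IH linear0.
  move=> c xi eta [k hk] [l hl]; exists (complex.Re `|c| * k + l) => n.
  rewrite iterD (le_trans (rnormD _ _))// mulrDl lerD// rnormZ -mulrA ler_wpM2l//.
  by rewrite -ler0c RRe_real.
have Grho y eta : G (rho y eta).
  exists (rnorm y * rnorm eta) => n.
  suff [z [zn zE]] : exists z, rnorm z <= D ^+ n * rnorm y /\ rho z eta = iter n S (rho y eta).
    rewrite -zE (le_trans (rnorm_app _ _))// rhoI mulrAC ler_wpM2r ?rnorm_ge0//.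
    by rewrite mulrC.
  elim: n => [|n [z [zn zE]]]; first by exists y; rewrite expr0 mul1r.
  have [w wE] := B_rho z BS; exists w; split; last by rewrite iterS -zE wE.
  rewrite -rhoI wE (le_trans (Sy z))// exprS -mulrA ler_wpM2l//; exact: ltW.
have GS xi : G xi -> rnorm (S xi) <= D * rnorm xi.
  move=> [k hk]; apply: (@log_convex_bounded _ (fun n => rnorm (iter n S xi)) k D) => // n.
    exact: rnorm_ge0.
  rewrite -rdotE /= radjE Ssa; exact: rdot_le.
case: rig => _ [_ _ [p [q [pqM pm _ P1 _]]]] _ _ _.
have pM i : M (p i) by case: (pqM i).
have {}P1 n : rnorm (\sum_(i < n) (p i \bo adj (p i))) <= 1 by rewrite rnorm_le1; exact: P1.
pose c nt := compression (a \o e) p nt.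
have c1 nt : rnorm (c nt) <= 1.
  by apply: compression_le1 => // t; rewrite /= aI.
(* G is not shown to be closed, so density would not be enough. The compressions map every vector
   into G itself, being finite sums of operators p_i a(e) p_i^* with p_i a(e) in rho(Y), and S c ->
   S in norm. *)
have Gc nt xi : G (c nt xi).
  rewrite /c /compression bop_sumE; apply: subspace_sum Gl _ => i.
  have [y yE] := rigging_memW rig (e nt.2) (pM i).
  by have := Grho y (adj (p i) xi); rewrite yE.
have Sc : S \bo c nt @[nt --> iter_filter F] --> S.
  apply: (B_compression RAs MMA FF _ _ pM pm P1 double BS).
    by move=> t; rewrite /= aI.
  by move=> x; exact: (rigging_cai_r rig FF er).
have SD : rnorm S <= D.
  apply/ler_addgt0Pr => d d0.
  have h : \forall nt \near iter_filter F, rnorm (S \bo c nt - S) < d.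
    exact: cvg_rnormP.1 Sc d d0.
  have [nt hnt] := filter_ex h.
  rewrite (le_trans (rnorm_le_sub _ (S \bo c nt)))// lerD//; last by rewrite rnormBC ltW.
  apply: rnorm_bop_le => [|xi]; first exact: ltW.
  rewrite (le_trans (GS _ (Gc nt xi)))// ler_wpM2l ?(ltW D0)//.
  by have := rnorm_app_le xi (c1 nt); rewrite mul1r.
by move: SD; rewrite SE rnorm_adj_comp /D expr2 ler_pM2l.
Qed.

(** The operator that T induces on Y through rho. It is chosen with default 0; its defining equation
    is available for T in B, which preserves rho(Y). *)
Let lift (T : bop K K) : bop Y Y :=
  xget 0 [set S : bop Y Y | forall y, rho (S y) = T \bo rho y].

Let lift_uniq T (S : bop Y Y) : (forall y, rho (S y) = T \bo rho y) -> lift T = S.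
Proof.
move=> h; rewrite /lift; case: xgetP => [S' _ /= h'|/(_ S)]; last by case.
by apply: bop_ext => y; apply: rhoinj; rewrite h h'.
Qed.

Let liftE T : B T -> forall y, rho (lift T y) = T \bo rho y.
Proof.
move=> BT; have ex y : exists z, rho z = T \bo rho y by exact: B_rho.
have [f fE] := choice ex.
have [c y z|y|S SE] := @mkbop _ _ _ f (rnorm T).
- by apply: rhoinj; rewrite linearP !fE linearP bcompDr bcompZr.
- by rewrite -rhoI fE (le_trans (rnorm_bcomp _ _))// rhoI.
- have SE' y : rho (S y) = T \bo rho y by rewrite SE fE.
  by rewrite (lift_uniq SE').
Qed.

Let lift_linear c S T : B S -> B T -> lift (c *: S + T) = c *: lift S + lift T.
Proof.
move=> BS BT; apply: lift_uniq => y.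
by rewrite bcompDl bcompZl -!liftE// -linearP.
Qed.

Let lift_sub S T : B S -> B T -> lift (S - T) = lift S - lift T.
Proof.
by move=> BS BT; apply: lift_uniq => y; rewrite bcompBl -!liftE// -linearB.
Qed.

Let lift_isometry T : B T -> rnorm (lift T) = rnorm T.
Proof.
move=> BT; apply/eqP; rewrite eq_le; apply/andP; split.
  apply: rnorm_bop_le => [|y]; first exact: rnorm_ge0.
  by rewrite -rhoI liftE// (le_trans (rnorm_bcomp _ _))// rhoI.
(* [B_norm_le] asks for a positive constant, hence the slack d, since the norm of the lift could be
   0. *)
apply/ler_addgt0Pr => d d0; apply: B_norm_le => // [|y].
  by rewrite ltr_wpDl ?rnorm_ge0.
rewrite -liftE// rhoI (le_trans (rnorm_app _ _))// ler_wpM2r ?rnorm_ge0//.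
by rewrite lerDl ltW.
Qed.

Let lift_rank1 y z x : lift (rho y \bo adj (rho z)) x = ract y (ip z x).
Proof.
apply: rhoinj; rewrite liftE; last exact: B_rank1.
by rewrite (rigging_ract rig) ipE bcompA.
Qed.

Lemma B_star_isomorphic :
  star_isomorphic (@bcomp R K K K) (@adj R K K) B
    (@bcomp R Y Y Y) (adjoint_wrt ip ip) (compact_ops ip).
Proof.
have [kl kc] := @cspan_closed_subspace R _ [set T : bop Y Y |
  exists y z : Y, forall x : Y, T x = ract y (ip z x)].
split; first exact: B_adj.
exists lift; split.
- split.
  (* Membership in B is carried along because [lift] is linear and isometric only there, and both
     properties are needed to see that the predicate defines a closed subspace. *)
  + suff h : B `<=` [set T | B T /\ compact_ops ip (lift T)].
      by move=> T /h[].
    apply: B_min_rank1 => [|y z]; last first.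
      split; first exact: B_rank1.
      by apply: sub_cspan; exists y, z => x; exact: lift_rank1.
    split; first split.
    * split; first exact: Bs.1.1.
      rewrite (lift_uniq (S := 0)); first exact: kl.1.
      by move=> y; rewrite bcomp0l linear0.
    * move=> c S T [BS kS] [BT kT]; split; first exact: Bs.1.2.
      by rewrite lift_linear//; exact: kl.2.
    * apply: closed_rnormW => T h.
      have BT : B T.
        by apply: closed_rnorm Bs.2 _ => d d0; have [S []] := h d d0; exists S.
      split=> //; apply: closed_rnorm kc _ => d d0.
      have [S [BS kS] TS] := h d d0; exists (lift S) => //.
      by rewrite -lift_sub// lift_isometry//; exact: subspaceB Bs.1 _ _.
  + move=> S T /set_mem BS /set_mem BT ST; apply/eqP; rewrite -subr_eq0.
    apply/eqP/rnorm_eq0; rewrite -lift_isometry; last exact: subspaceB Bs.1 _ _.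
    by rewrite lift_sub// ST subrr rnorm0.
  + apply: cspan_min => [|T [y [z Tyz]]].
      apply: image_closed_subspace => //; first exact: bop_seq_complete.
    exists (rho y \bo adj (rho z)); first exact: B_rank1.
    by apply: bop_ext => x; rewrite lift_rank1 Tyz.
- by move=> c S T; exact: lift_linear.
- move=> S T BS BT; apply: lift_uniq => y.
  by rewrite [in LHS]/= !liftE// bcompA.
- move=> T BT; have BT' := B_adj BT.
  have adjT x y : ip (lift T x) y = ip x (lift (adj T) y).
    by apply: ainj; rewrite !ipE !liftE// adj_comp bcompA.
  (* The choice could return any adjoint; definiteness of the inner product leaves only one. *)
  rewrite /adjoint_wrt; case: xgetP => [S _ /= h|/(_ (lift (adj T)))]; last by case.
  apply: bop_ext => y; apply/eqP; rewrite -subr_eq0; apply/eqP.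
  apply: (ip_eq0 aI rhoI ipE); set w := lift (adj T) y - S y.
  by rewrite /w (ipBr aI ipE) -adjT h subrr.
Qed.

End DoubleRigging.

Theorem theorem3p4 (R : realType) (A : opalgType R) (Y : rightOpModType A) :
  approximately_unital A ->
  doubly_sigmaDelta_rigged Y ->
  exists (H K : hilbertType R) (A0 : set (bop H H)) (B : set (bop K K))
    (phi : {linear Y -> bop H K}),
    [/\ concrete_operator_algebra A0 /\ has_cai (@bcomp R H H H) A0,
        concrete_operator_algebra B /\ has_cai (@bcomp R K K K) B,
        completely_isometric phi,
        sigmaTRO_equiv A0 B
      & sigmaTRO_equiv B (range phi)] /\
    (forall star : A -> A, is_Cstar_involution star ->
     forall (H' K' : hilbertType R) (a : {linear A -> bop H' H'})
       (M : set (bop H' K')) (rho : {linear Y -> bop H' K'}),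
       is_rigging a M rho ->
       let ip := rigging_ip a rho in
       star_isomorphic (@bcomp R H H H) (@adj R H H) A0
         (@opmul R A) star (ip_ideal ip) /\
       star_isomorphic (@bcomp R K K K) (@adj R K K) B
         (@bcomp R Y Y Y) (adjoint_wrt ip ip) (compact_ops ip)).
Proof.
move=> [I [F [e [FF e1 el er]]]] [H [K [a [M [rho [rig double]]]]]].
have {}e1 t : rnorm (e t) <= 1 by rewrite rnorm_le1; case: (e1 t).
have {}el x : opmul (e t) x @[t --> F] --> x by exact: el.
have {}er x : opmul x (e t) @[t --> F] --> x by exact: er.
have RAs := rigging_range_closed rig.
have RAm := rigging_rangeM rig.
have MMA := rigging_range_TRO rig.
have ael := rigging_cai_l rig FF el; have aer := rigging_cai_r rig FF er.
have ae t : range a (a (e t)) by exists (e t).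
have ae1 t : rnorm (a (e t)) <= 1 by rewrite (rigging_isometry rig).
have [_ Msig _ [rhoI rhoW] _] := rig.
have [_ _ [p [q [pqM pm mq P1 Q1]]]] := Msig.
have pM i : M (p i) by case: (pqM i).
have qM i : M (q i) by case: (pqM i).
have {}P1 n : rnorm (\sum_(i < n) (p i \bo adj (p i))) <= 1 by rewrite rnorm_le1; exact: P1.
have {}Q1 n : rnorm (\sum_(i < n) (adj (q i) \bo q i)) <= 1 by rewrite rnorm_le1; exact: Q1.
exists H, K, (cspan (bprod (bprod (@adj R H K @` M) M) (range a))),
  (cspan (bprod (bprod M (range a)) (@adj R H K @` M))), rho.
split; first split.
- split; first exact: A0_operator_algebra.
  exact: (A0_has_cai RAs MMA FF ae ae1 ael aer qM mq Q1).
- split; first exact: B_operator_algebra.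
  exact: (B_has_cai RAs MMA FF ae ae1 ael aer pM pm P1).
- exact: rhoI.
- exact: (A0_equiv_B RAs Msig MMA qM mq Q1).
- by rewrite rhoW; exact: (B_equiv_W RAs Msig MMA qM mq).
move=> star starP H' K' a' M' rho' rig'.
(* A0 and B come from the doubly rigged representation, while the inner product here comes from the
   given one; uniqueness moves the claim to the former. *)
rewrite (rigging_ip_unique starP FF e1 el er rig rig') /=.
split; first exact: (A0_star_isomorphic rig double FF e1 el er starP).
exact: (B_star_isomorphic rig double FF e1 el er starP).
Qed.
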